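(* In the general framework described in the context (no oversampling), consider the Galerkin MsFEM: find $u_H^\varepsilon\in V_{H,0}^\varepsilon$ such that $\sum_{K}a_K^\varepsilon(u_H^\varepsilon,v_H^\varepsilon)=F(v_H^\varepsilon)$ for all $v_H^\varepsilon\in V_{H,0}^\varepsilon$. Suppose that the sampling form satisfies $s_K^\varepsilon=a_K^\varepsilon$ (on $V_K\times V_K$) for all $K\in\mathcal T_H$. Then the matrix of this Galerkin MsFEM coincides with the matrix of the corresponding Petrov-Galerkin MsFEM, i.e. $$\sum_{K\in\mathcal T_H}a_K^\varepsilon(\phi_i^\varepsilon,\phi_j^\varepsilon)=\sum_{K\in\mathcal T_H}a_K^\varepsilon(\phi_i^\varepsilon,\phi_j)\qquad\text{for all }1\le i,j\le N_0.$$ Consequently, the non-intrusive Galerkin MsFEM $$\text{find }u_H^\varepsilon\in V_{H,0}^\varepsilon\text{ such that }\sum_{K\in\mathcal T_H}a_K^\varepsilon(u_H^\varepsilon,\phi_j^\varepsilon)=F(\phi_j)\text{ for all }1\le j\le N_0$$ coincides with the Petrov-Galerkin MsFEM $$\text{find }u_H^\varepsilon\in V_{H,0}^\varepsilon\text{ such that }\sum_{K\in\mathcal T_H}a_K^\varepsilon(u_H^\varepsilon,v_H)=F(v_H)\text{ for all }v_H\in V_{H,0},$$ and in particular the Petrov-Galerkin MsFEM is well-posed (has a unique solution).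
   Context: $\Omega\subset\mathbb R^d$ ($d\ge1$) is a bounded polytope and $\mathcal T_H$ a conformal simplicial mesh of $\Omega$. $P_1(\mathcal T_H)$ is the space of functions that are affine on each $K\in\mathcal T_H$. For each $K\in\mathcal T_H$, $a_K^\varepsilon$ is a continuous bilinear form on $H^1(K)\times H^1(K)$, and $a^\varepsilon=\sum_K a_K^\varepsilon$ is coercive on $H_0^1(\Omega)$. Moreover for each $K$ there is $\alpha_K>0$ with $a_K^\varepsilon(u,u)\ge\alpha_K\|\nabla u\|_{L^2(K)}^2$ for all $u\in H^1(K)$. $f\in L^2(\Omega)$ and $F(v)=\int_\Omega f v$. $x_{c,K}$ is the centroid of $K$, $x^\alpha$ the $\alpha$-th coordinate function, $x_{c,K}^\alpha$ the $\alpha$-th coordinate of $x_{c,K}$. Underlying $P_1$ space and degrees of freedom. $V_H$ is one of: (MsFEM-lin) the space of functions in $P_1(\mathcal T_H)$ continuous on $\Omega$; (MsFEM-CR) the Crouzeix-Raviart space of $v\in P_1(\mathcal T_H)$ whose jump has zero integral over every interior face. For a simplex $K$ and $v\in P_1(K)$, the degree-of-freedom (DOF) operator $\Gamma(K,v)\in\mathbb R^{d+1}$ is the vector of values of $v$ at the $d+1$ vertices of $K$ (MsFEM-lin), or of averages of $v$ over the $d+1$ faces of $K$ (MsFEM-CR); it is a linear bijection $P_1(K)\to\mathbb R^{d+1}$. The degrees of freedom attached to mesh vertices (resp. faces) lying on $\partial\Omega$ are said to be associated to the boundary. $V_{H,0}$ is the space of $v\in V_H$ all of whose degrees of freedom associated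 to the boundary vanish. $\phi_1,\dots,\phi_N$ is the basis of $V_H$ dual to the vertices (lin) or to the faces (CR) of the mesh (value, resp. face average, $\delta_{ij}$), ordered so that $\phi_1,\dots,\phi_{N_0}$ is a basis of $V_{H,0}$. Sampling space and form (no oversampling). For each $K$, $V_K\subset H^1(K)$ is a subspace and $s_K^\varepsilon:V_K\times V_K\to\mathbb R$ a bilinear form such that: $P_1(K)\subset V_K$; $\Gamma(K,\cdot)$ is well-defined on $V_K$; and, with $V_{K,0}=\{w\in V_K:\Gamma(K,w)=0\}$, for every $g\in(H^1(K))'$ and every prescribed value of $\Gamma(K,v)$ there is a unique $v\in V_K$ with $s_K^\varepsilon(v,w)=\langle g,w\rangle$ for all $w\in V_{K,0}$ and $\Gamma(K,v)$ equal to the prescribed value. Numerical correctors and multiscale functions. For $0\le\alpha\le d$, $\chi_K^\alpha\in V_{K,0}$ is the unique solution of: for all $w\in V_{K,0}$, $s_K^\varepsilon(\chi_K^0,w)=-s_K^\varepsilon(1,w)$ if $\alpha=0$, and $s_K^\varepsilon(\chi_K^\alpha,w)=-s_K^\varepsilon(x^\alpha-x^\alpha_{c,K},w)$ if $1\le\alpha\le d$; it is extended by $0$ outside $K$. For $1\le i\le N$, $\phi_i^\varepsilon|_K=\phi_i|_K+\phi_i|_K(x_{c,K})\chi_K^0+\sum_{\alpha=1}^d\partial_\alpha(\phi_i|_K)\chi_K^\alpha$ for all $K\in\mathcal T_H$. $V_{H,0}^\varepsilon=\mathrm{span}\{\phi_i^\varepsilon:1\le i\le N_0\}$. *)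

(* Defs.v *)
From HB Require Import structures.
From mathcomp Require Import all_boot all_order all_algebra.
From mathcomp Require Import all_classical all_reals all_analysis.

Set Implicit Arguments.
Unset Strict Implicit.
Unset Printing Implicit Defensive.

Import Order.TTheory GRing.Theory Num.Theory.
Import numFieldNormedType.Exports.

Local Open Scope classical_set_scope.
Local Open Scope ring_scope.

(* The sigma-algebra generated by the coordinates is the Borel one. *)
Section row_measurable.
Context {R : realType} {k : nat}.

Let coor : 'I_k -> 'rV[R]_k -> R := fun i x => x ord0 i.

Let row_set0 : g_sigma_preimage coor set0.
Proof. exact: sigma_algebra0. Qed.

Let row_setC A : g_sigma_preimage coor A -> g_sigma_preimage coor (~` A).
Proof. exact: sigma_algebraC. Qed.

Let row_bigcup (F : (set 'rV[R]_k)^nat) : (forall i, g_sigma_preimage coor (F i)) ->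
  g_sigma_preimage coor (\bigcup_i (F i)).
Proof. exact: sigma_algebra_bigcup. Qed.

HB.instance Definition _ := @isMeasurable.Build
  (measure_tuple_display default_measure_display)
  'rV[R]_k (g_sigma_preimage coor) row_set0 row_setC row_bigcup.

End row_measurable.

Lemma measurable_coor (R : realType) k (i : 'I_k) :
  measurable_fun [set: 'rV[R]_k] (fun x : 'rV[R]_k => x ord0 i).
Proof.
move=> _ Y mY; rewrite setTI; apply: sub_sigma_algebra => /=.
rewrite -bigcup_seq/=; exists i => /=; first by rewrite mem_index_enum.
by exists Y => //; rewrite setTI.
Qed.

Lemma measurable_fun_row d (T : measurableType d) (R : realType) k
    (f : T -> 'rV[R]_k) :
  (forall i, measurable_fun [set: T] (fun x => f x ord0 i)) ->
  measurable_fun [set: T] f.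
Proof.
move=> mf _ A; rewrite setTI => mA.
pose G := [set B : set 'rV[R]_k | measurable (f @^-1` B)].
suff : measurable `<=` G by move=> /(_ _ mA).
apply: smallest_sub.
  split => [|B GB|F GF]; rewrite /G /=.
  - by rewrite preimage_set0; exact: measurable0.
  - by rewrite setTD preimage_setC; exact: measurableC.
  - by rewrite preimage_bigcup; apply: bigcup_measurable => i _; exact: GF.
move=> B; rewrite -bigcup_seq => -[i _ [C mC <-]]; rewrite /G /= setTI.
by have := mf i measurableT _ mC; rewrite setTI.
Qed.

Section row_lebesgue.
Context {R : realType}.

Definition row_cons k (z : measurableTypeR R * 'rV[R]_k) : 'rV[R]_k.+1 :=
  \row_i oapp (z.2 ord0) (z.1 : R) (unlift ord0 i).

Definition row_uncons k (x : 'rV[R]_k.+1) : measurableTypeR R * 'rV[R]_k :=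
  (x ord0 ord0, \row_i x ord0 (lift ord0 i)).

Lemma row_consK k : cancel (@row_cons k) (@row_uncons k).
Proof.
move=> [t x]; rewrite /row_uncons /row_cons !mxE unlift_none /=; congr pair.
by apply/rowP => i; rewrite !mxE liftK.
Qed.

Lemma row_unconsK k : cancel (@row_uncons k) (@row_cons k).
Proof.
by move=> x; apply/rowP => i; rewrite mxE; case: unliftP => [j|] -> //=; rewrite mxE.
Qed.

Lemma measurable_row_cons k : measurable_fun setT (@row_cons k).
Proof.
apply: measurable_fun_row => i; rewrite /row_cons.
under eq_fun do rewrite mxE.
case: unliftP => [j|] _ /=.
  apply: (measurableT_comp (measurable_coor j)); exact: measurable_snd.
exact: measurable_fst.
Qed.

Lemma measurable_row_uncons k : measurable_fun setT (@row_uncons k).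
Proof.
apply: measurable_fun_pair; first exact: measurable_coor.
apply: measurable_fun_row => i.
under eq_fun do rewrite mxE.
exact: measurable_coor.
Qed.

Section step.
Context k (mu : {sigma_finite_measure set 'rV[R]_k -> \bar R}).

Definition lebesgue_step : set 'rV[R]_k.+1 -> \bar R :=
  pushforward (@lebesgue_measure R \x mu)%E (@row_cons k).

Let step_measure : {measure set 'rV[R]_k.+1 -> \bar R} :=
  measure_function_pushforward__canonical__measure_function_Measure
    (@lebesgue_measure R \x mu)%E (@measurable_row_cons k).

HB.instance Definition _ := isMeasure.Build _ _ _ lebesgue_step
  (measure0 step_measure) (measure_ge0 step_measure)
  (@measure_semi_sigma_additive _ _ _ step_measure).

Let step_sigma_finite : sigma_finite setT lebesgue_step.
Proof.
have /sigma_finiteP[F [TF ndF Foo]] := sigma_finiteT (@lebesgue_measure R).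
have /sigma_finiteP[G [TG ndG Goo]] := sigma_finiteT mu.
exists (fun i => @row_uncons k @^-1` (F i `*` G i)).
  rewrite -preimage_bigcup; apply/esym/seteqP; split=> // x _ /=.
  have : [set: R] (row_uncons x).1 by [].
  rewrite TF => -[i _ Fi].
  have : [set: 'rV[R]_k] (row_uncons x).2 by [].
  rewrite TG => -[j _ Gj].
  exists (maxn i j) => //; split.
  - by move: Fi; exact/subsetPset/ndF/leq_maxl.
  - by move: Gj; exact/subsetPset/ndG/leq_maxr.
move=> i; have [mF Fy] := Foo i; have [mG Gy] := Goo i; split.
  rewrite -[X in measurable X]setTI.
  by apply: measurable_row_uncons => //; exact: measurableX.
rewrite /lebesgue_step /pushforward -comp_preimage.
rewrite (_ : _ \o _ = id) ?preimage_id; last first.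
  by apply/funext => z /=; rewrite row_consK.
by rewrite product_measure1E// lte_mul_pinfty// ge0_fin_numE.
Qed.

HB.instance Definition _ := Measure_isSigmaFinite.Build _ _ _ lebesgue_step
  step_sigma_finite.

End step.

(* The only point of ['rV[R]_0] has mass 1; the measure in dimension k.+1 is
   the product of the one in dimension 1 and the one in dimension k. *)
Fixpoint lebesgue_row k : {sigma_finite_measure set 'rV[R]_k -> \bar R} :=
  match k with
  | 0 => \d_(0 : 'rV[R]_0)
  | k'.+1 => lebesgue_step (lebesgue_row k')
  end.

End row_lebesgue.

Section sobolev.
Context {R : realType}.

Definition L2 k (D : set 'rV[R]_k) : set ('rV[R]_k -> R) :=
  [set u | (u \_ D : 'rV[R]_k -> R) \in Lfun (lebesgue_row k) 2%:E].

Definition L2norm k (D : set 'rV[R]_k) (u : 'rV[R]_k -> R) : R :=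
  fine ('N[lebesgue_row k]_2%:E[EFin \o (u \_ D)])%E.

Context {n : nat}.
Implicit Types (D : set 'rV[R]_n.+1) (u v : 'rV[R]_n.+1 -> R)
  (g : 'I_n.+1 -> 'rV[R]_n.+1 -> R).

Definition partial (b : 'I_n.+1) u : 'rV[R]_n.+1 -> R :=
  fun x => 'D_(delta_mx ord0 b) u x.

Definition smooth u : Prop := forall s : seq 'I_n.+1,
  let ds := foldr partial u s in
  continuous ds /\ forall x b, derivable ds x (delta_mx ord0 b).

Definition test_function D : set ('rV[R]_n.+1 -> R) :=
  [set psi | smooth psi /\
    exists2 A, compact A /\ A `<=` D & forall x, ~ A x -> psi x = 0].

(* The dimension d >= 1 of the space is n.+1.
   Elements of L^2(D) and H^1(D) are represented by functions on the whole
   space, of which only the values on D matter; two of them are the same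
   element when they are equal almost everywhere on D. The gradient is a
   relation since it is only defined up to almost everywhere equality. *)
Definition weak_grad D u g : Prop := forall b, L2 D (g b) /\
  forall psi, test_function D psi ->
    \int[lebesgue_row n.+1]_(x in D) (u x * partial b psi x) =
    - \int[lebesgue_row n.+1]_(x in D) (g b x * psi x).

Definition H1 D : set ('rV[R]_n.+1 -> R) :=
  [set u | L2 D u /\ exists g, weak_grad D u g].

(* The H^1(D) norm of u, where g is the weak gradient of u. *)
Definition H1norm D u g : R :=
  Num.sqrt (L2norm D u ^+ 2 + \sum_b L2norm D (g b) ^+ 2).

(* The smooth functions w j converge to u in H^1(D), where g is the weak
   gradient of u. *)
Definition H1cvg D (w : nat -> 'rV[R]_n.+1 -> R) u g : Prop :=
  H1norm D (fun x => w j x - u x) (fun b x => partial b (w j) x - g b x)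
    @[j --> \oo] --> (0 : R).

Definition H10 D : set ('rV[R]_n.+1 -> R) :=
  [set u | L2 D u /\ exists2 g, weak_grad D u g &
    exists2 w, (forall j, test_function D (w j)) & H1cvg D w u g].

Definition H1dual D (l : ('rV[R]_n.+1 -> R) -> R) : Prop :=
  (forall c u v, H1 D u -> H1 D v ->
    l (fun x => c * u x + v x) = c * l u + l v) /\
  exists C, forall u g, H1 D u -> weak_grad D u g ->
    `|l u| <= C * H1norm D u g.

Definition bilinear_on (V : set ('rV[R]_n.+1 -> R))
    (b : ('rV[R]_n.+1 -> R) -> ('rV[R]_n.+1 -> R) -> R) : Prop :=
  forall c u v w, V u -> V v -> V w ->
    b (fun x => c * u x + v x) w = c * b u w + b v w /\
    b w (fun x => c * u x + v x) = c * b w u + b w v.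

Definition continuous_form D
    (b : ('rV[R]_n.+1 -> R) -> ('rV[R]_n.+1 -> R) -> R) : Prop :=
  exists C, forall u gu v gv, H1 D u -> weak_grad D u gu ->
    H1 D v -> weak_grad D v gv ->
    `|b u v| <= C * H1norm D u gu * H1norm D v gv.

End sobolev.

Section simplices.
Context {R : realType} {n : nat}.
Implicit Types (p : 'I_n.+2 -> 'rV[R]_n.+1) (v : 'rV[R]_n.+1 -> R).

Definition affine_independent p : Prop := forall l : 'I_n.+2 -> R,
  \sum_i l i = 0 -> \sum_i l i *: p i = 0 -> forall i, l i = 0.

(* The convex hull of the p i with i in I, which is empty if I is. *)
Definition face p (I : set 'I_n.+2) : set 'rV[R]_n.+1 :=
  [set x | exists l : 'I_n.+2 -> R,
    [/\ forall i, 0 <= l i, forall i, ~ I i -> l i = 0, \sum_i l i = 1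
      & x = \sum_i l i *: p i]].

Definition simplex p : set 'rV[R]_n.+1 := face p setT.

Definition facet p (i : 'I_n.+2) : set 'rV[R]_n.+1 := face p (~` [set i]).

Definition centroid p : 'rV[R]_n.+1 := n.+2%:R^-1 *: \sum_i p i.

(* Affine parametrization of facet p i by the reference simplex of R^n. *)
Definition ref_simplex : set 'rV[R]_n :=
  [set t | (forall j, 0 <= t ord0 j) /\ \sum_j t ord0 j <= 1].

Definition facet_param p (i : 'I_n.+2) (t : 'rV[R]_n) : 'rV[R]_n.+1 :=
  p (lift i ord0) +
  \sum_j t ord0 j *: (p (lift i (lift ord0 j)) - p (lift i ord0)).

(* The surface integral over facet p i, up to the constant Jacobian of
   facet_param p i. *)
Definition facet_int p i v : R :=
  \int[lebesgue_row n]_(t in ref_simplex) v (facet_param p i t).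

Definition facet_mean p i v : R := facet_int p i v / facet_int p i (cst 1).

(* An affine function on a simplex is identified with the unique affine
   function on the whole space that extends it. *)
Definition P1 : set ('rV[R]_n.+1 -> R) :=
  [set v | exists c (a : 'I_n.+1 -> R),
    v = fun x : 'rV[R]_n.+1 => c + \sum_b a b * x ord0 b].

Variant msfem := MsFEM_lin | MsFEM_CR.

Definition dof_support (k : msfem) p i : set 'rV[R]_n.+1 :=
  match k with MsFEM_lin => [set p i] | MsFEM_CR => facet p i end.

(* Gamma(K, v) for v in P_1(K), K = simplex p. *)
Definition dof_P1 (k : msfem) p v (i : 'I_n.+2) : R :=
  match k with MsFEM_lin => v (p i) | MsFEM_CR => facet_mean p i v end.

(* h is the trace of v, an element of H^1(K), on facet p i: the limit in
   L^2(facet p i) of smooth functions converging to v in H^1(K). *)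
Definition is_trace p i v (h : 'rV[R]_n.+1 -> R) : Prop :=
  L2 ref_simplex (h \o facet_param p i) /\
  exists g, (L2 (simplex p)° v /\ weak_grad (simplex p)° v g) /\
  exists w : nat -> 'rV[R]_n.+1 -> R,
    [/\ forall j, smooth (w j), H1cvg (simplex p)° w v g
      & L2norm ref_simplex
          (fun t => w j (facet_param p i t) - h (facet_param p i t))
          @[j --> \oo] --> (0 : R)].

(* On H^1(K), the degrees of freedom are those of the trace on the boundary
   of K. For MsFEM-lin, only the continuity of that trace at the vertex is
   required, not the one of v itself: functions of H^1(K) which are affine on
   the boundary of K need not be continuous. *)
Definition is_dof (k : msfem) p v (i : 'I_n.+2) (y : R) : Prop :=
  match k with
  | MsFEM_lin => forall j, j != i -> exists2 h, is_trace p j v h &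
      h x @[x --> within (facet p j) (nbhs (p i))] --> y
  | MsFEM_CR => exists2 h, is_trace p i v h & y = facet_mean p i h
  end.

(* Gamma(K, v) for v in V_K, K = simplex p. *)
Definition dof (k : msfem) p v : 'I_n.+2 -> R :=
  fun i => get [set y | is_dof k p v i y].

(* A polytope need not be convex. *)
Definition polytope (Omega : set 'rV[R]_n.+1) : Prop :=
  Omega = (closure Omega)° /\
  exists m (p : 'I_m -> 'I_n.+2 -> 'rV[R]_n.+1),
    (forall j, affine_independent (p j)) /\
    closure Omega = \bigcup_j simplex (p j).

Definition conformal_mesh (Omega : set 'rV[R]_n.+1) m
    (T : 'I_m -> 'I_n.+2 -> 'rV[R]_n.+1) : Prop :=
  [/\ forall K, affine_independent (T K),
      closure Omega = \bigcup_K simplex (T K)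
    & forall K L, K != L -> exists I J, [/\ I <> setT,
        face (T K) I = face (T L) J
      & simplex (T K) `&` simplex (T L) = face (T K) I]].

Definition boundary (Omega : set 'rV[R]_n.+1) : set 'rV[R]_n.+1 :=
  closure Omega `\` Omega.

End simplices.

(* A piecewise defined function is the family of its restrictions to the
   elements of the mesh, for it can have several values on their boundaries.
   The restriction to K is a function as in H1 or P1 above. *)
Definition broken (R : realType) (n m : nat) : Type :=
  'I_m -> 'rV[R]_n.+1 -> R.

Section msfem.
Context {R : realType} {n m : nat}.
Variables (k : msfem) (Omega : set 'rV[R]_n.+1)
  (T : 'I_m -> 'I_n.+2 -> 'rV[R]_n.+1).

Definition lincomb N (c : 'I_N -> R) (b : 'I_N -> broken R n m) :
  broken R n m := fun K x => \sum_j c j * b j K x.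

Definition is_basis N (V : set (broken R n m)) (b : 'I_N -> broken R n m) :
  Prop := (forall j, V (b j)) /\
  forall v, V v -> exists! c : 'I_N -> R, v = lincomb c b.

Definition span N (b : 'I_N -> broken R n m) : set (broken R n m) :=
  [set v | exists c, v = lincomb c b].

(* Two distinct elements having a facet in common are on the two sides of an
   interior face. *)
Definition VH : set (broken R n m) :=
  [set v | (forall K, P1 (v K)) /\
    match k with
    | MsFEM_lin => exists2 w : 'rV[R]_n.+1 -> R, {within Omega, continuous w} &
        forall K x, simplex (T K) x -> Omega x -> w x = v K x
    | MsFEM_CR => forall K L i j, K != L -> facet (T K) i = facet (T L) j ->
        facet_int (T K) i (fun x => v K x - v L x) = 0
    end].

Definition VH0 : set (broken R n m) :=
  [set v | VH v /\ forall K i, dof_support k (T K) i `<=` boundary Omega ->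
    dof_P1 k (T K) (v K) i = 0].

(* The D j are the vertices (as singletons) or the faces of the mesh. *)
Definition dof_enumeration N (D : 'I_N -> set 'rV[R]_n.+1) : Prop :=
  injective D /\
  range D = [set F | exists K i, F = dof_support k (T K) i].

Definition dual_to N (D : 'I_N -> set 'rV[R]_n.+1)
    (phi : 'I_N -> broken R n m) : Prop :=
  forall j K i,
    dof_P1 k (T K) (phi j K) i = `[< D j = dof_support k (T K) i >]%:R.

Definition total_form
    (a : 'I_m -> ('rV[R]_n.+1 -> R) -> ('rV[R]_n.+1 -> R) -> R)
    (u v : broken R n m) : R := \sum_K a K (u K) (v K).

Definition coercive_form
    (a : 'I_m -> ('rV[R]_n.+1 -> R) -> ('rV[R]_n.+1 -> R) -> R) : Prop :=
  exists2 c, 0 < c & forall u g, H10 Omega u -> weak_grad Omega u g ->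
    c * H1norm Omega u g ^+ 2 <= total_form a (fun=> u) (fun=> u).

(* The interiors of the elements are pairwise disjoint and cover Omega up to a
   null set, so this is v as an almost everywhere defined function on Omega. *)
Definition glue (v : broken R n m) (x : 'rV[R]_n.+1) : R :=
  \sum_K \1_((simplex (T K))°) x * v K x.

Definition load (f : 'rV[R]_n.+1 -> R) (v : broken R n m) : R :=
  \int[lebesgue_row n.+1]_(x in Omega) (f x * glue v x).

Definition kernel_space (V : set ('rV[R]_n.+1 -> R)) (p : 'I_n.+2 -> 'rV[R]_n.+1) :
  set ('rV[R]_n.+1 -> R) := [set w | V w /\ forall i, dof k p w i = 0].

(* V is a subspace of H^1(K), K = simplex p: it is closed under linear
   combinations and under almost everywhere equality. *)
Definition sampling_space (p : 'I_n.+2 -> 'rV[R]_n.+1)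
    (V : set ('rV[R]_n.+1 -> R)) : Prop :=
  [/\ V `<=` H1 (simplex p)°,
      forall c u v, V u -> V v -> V (fun x => c * u x + v x),
      forall u v, V u -> H1 (simplex p)° v ->
        u = v %[ae lebesgue_row n.+1 in (simplex p)°] -> V v,
      P1 `<=` V
    & forall v i, V v -> exists! y, is_dof k p v i y].

Definition sampling_form (p : 'I_n.+2 -> 'rV[R]_n.+1)
    (V : set ('rV[R]_n.+1 -> R))
    (s : ('rV[R]_n.+1 -> R) -> ('rV[R]_n.+1 -> R) -> R) : Prop :=
  [/\ bilinear_on V s,
      forall u v w, V u -> V v -> V w ->
        u = v %[ae lebesgue_row n.+1 in (simplex p)°] ->
        s u w = s v w /\ s w u = s w v
    & forall (l : ('rV[R]_n.+1 -> R) -> R) (y : 'I_n.+2 -> R),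
        H1dual (simplex p)° l ->
        let sol v := [/\ V v, forall w, kernel_space V p w -> s v w = l w
          & dof k p v = y] in
        (exists v, sol v) /\
        forall u v, sol u -> sol v ->
          u = v %[ae lebesgue_row n.+1 in (simplex p)°]].

(* The index 0 stands for alpha = 0, and lift ord0 b for the coordinate b. *)
Definition corrector_data (p : 'I_n.+2 -> 'rV[R]_n.+1) (al : 'I_n.+2) :
  'rV[R]_n.+1 -> R :=
  match unlift ord0 al with
  | None => cst 1
  | Some b => fun x => x ord0 b - centroid p ord0 b
  end.

Definition correctors (p : 'I_n.+2 -> 'rV[R]_n.+1)
    (V : set ('rV[R]_n.+1 -> R))
    (s : ('rV[R]_n.+1 -> R) -> ('rV[R]_n.+1 -> R) -> R)
    (chi : 'I_n.+2 -> 'rV[R]_n.+1 -> R) : Prop :=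
  forall al, kernel_space V p (chi al) /\
    forall w, kernel_space V p w -> s (chi al) w = - s (corrector_data p al) w.

Definition multiscale (chi : 'I_m -> 'I_n.+2 -> 'rV[R]_n.+1 -> R)
    (phi : broken R n m) : broken R n m := fun K x =>
  phi K x + phi K (centroid (T K)) * chi K ord0 x +
  \sum_b partial b (phi K) (centroid (T K)) * chi K (lift ord0 b) x.

Definition petrov_galerkin N
    (a : 'I_m -> ('rV[R]_n.+1 -> R) -> ('rV[R]_n.+1 -> R) -> R)
    (f : 'rV[R]_n.+1 -> R) (phie : 'I_N -> broken R n m) (u : broken R n m) :
  Prop := span phie u /\ forall v, VH0 v -> total_form a u v = load f v.

Definition nonintrusive_galerkin N
    (a : 'I_m -> ('rV[R]_n.+1 -> R) -> ('rV[R]_n.+1 -> R) -> R)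
    (f : 'rV[R]_n.+1 -> R) (phi phie : 'I_N -> broken R n m)
    (u : broken R n m) : Prop :=
  span phie u /\ forall j, total_form a u (phie j) = load f (phi j).

End msfem.

(* Main.v *)
Require Import Defs.
From mathcomp Require Import all_boot all_order all_algebra.
From mathcomp Require Import all_classical all_reals all_analysis.
From mathcomp Require Import measurable_realfun.
From mathcomp Require Import ring lra.

Set Implicit Arguments.
Unset Strict Implicit.
Unset Printing Implicit Defensive.

Import Order.TTheory GRing.Theory Num.Theory.
Import numFieldNormedType.Exports.

Local Open Scope classical_set_scope.
Local Open Scope ring_scope.

(** On an element K, the equations of the correctors express that the multiscale
function built from a P1 function v is orthogonal, for s_K, to the kernel V_{K,0} of
the degrees of freedom: v is its own Taylor expansion at the centroid, and each
corrector cancels one term of that expansion against V_{K,0}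
([add_correctors_orth]). Since phi_j^eps and phi_j differ on K by an element of
V_{K,0}, exchanging them as test functions does not change the form once s_K = a_K
([galerkin_matrix]). By bilinearity of the form, and linearity of the load over
broken P1 functions ([load_lin]), the two methods have the same solutions.

They amount to a square linear system, so that well-posedness reduces to a trivial
kernel ([petrov_galerkin_inj]). Let u = sum_j e_j phi_j^eps be in this kernel and let
v = sum_j e_j phi_j. The equality of the matrices gives a(u, u) = 0, and the
coercivity on each element makes the gradient of u vanish on each element.

- Hence u is constant almost everywhere on each element K
  ([is_trace_grad0_cst]). The existence of degrees of freedom implies the one of a
  trace, thus of smooth functions w_j converging to u in H^1(K); the integral of
  |w_j(x + h) - w_j(x)| over the points such that x and x + h are in K is bounded by
  the one of |h . grad w_j| ([translation_bound]), which tends to 0. The limit u is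
  therefore invariant under the translations inside K, and constant by Fubini's
  theorem ([translation_invariant_cst]).
- The degrees of freedom of u on K are all equal, and they are those of v. The dual
  basis makes the degrees of freedom unisolvent on P1 ([P1_dual_expansion]), so v is
  constant on K ([dof_P1_cst_inv]).
- A function of V_{H,0} that is constant on each element is zero
  ([VH0_piecewise_constant]). For MsFEM-lin, consider the vertex of largest first
  coordinate among the elements where v takes a given value: by continuity, it is on
  the boundary ([piecewise_constant_continuous]). For MsFEM-CR, the values are equal
  on both sides of an interior face; a line in general position leaves the
  elements where v takes a given value through a face that no other element has
  ([exit_facet]), and such a face is on the boundary
  ([unshared_facet_boundary]).

Thus v = 0 and e = 0. *)

(** * The Lebesgue measure on row vectors *)

Section row_measure.
Context {R : realType}.

Lemma row_ballP k (x y : 'rV[R]_k) (e : R) :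
  ball x e y <-> 0 < e /\ forall i, `|x ord0 i - y ord0 i| < e.
Proof.
split => [[e0 h]|[e0 h]]; split => // i; first exact: (h ord0 i).
by move=> j; rewrite (ord1 i); exact: h.
Qed.

(** An open set is the union of the countably many cubes with rational center and radius
that it contains. *)
Lemma open_measurable_row k (A : set 'rV[R]_k) : open A -> measurable A.
Proof.
move=> oA.
pose B (q : 'rV[rat]_k * rat) : set 'rV[R]_k :=
  [set x | forall i, `|ratr (q.1 ord0 i) - x ord0 i| < ratr q.2].
have mB q : measurable (B q).
  rewrite (_ : B q = \bigcap_i [set x | `|ratr (q.1 ord0 i) - x ord0 i| < ratr q.2]);
    last by apply/seteqP; split => x /= h i *; exact: h.
  apply: fin_bigcap_measurable => // i _.
  rewrite -[X in measurable X]setTI.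
  apply: (@measurable_coor R k i measurableT
    [set y | `|ratr (q.1 ord0 i) - y| < ratr q.2]).
  rewrite (_ : mkset _ =
    `](ratr (q.1 ord0 i) - ratr q.2), (ratr (q.1 ord0 i) + ratr q.2)[%classic) //.
  by apply/seteqP; split => y; rewrite /= in_itv /= ltr_distlC.
pose U n := if unpickle n is Some q then
   if pselect (B q `<=` A) then B q else set0 else set0.
rewrite (_ : A = \bigcup_n U n); last first.
  apply/seteqP; split => [x Ax|x [n _]]; last first.
    rewrite /U; case: unpickle => // q; case: pselect => // BA; exact: BA.
  have /nbhs_ballP[e /= e0 eA] : nbhs x A by exact: open_nbhs_nbhs.
  have [r /itvP re] := @rat_in_itvoo R 0 (e / 2) (divr_gt0 e0 (ltr0Sn _ _)).
  have hq i : exists q : rat, `|ratr q - x ord0 i| < ratr r.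
    have [|q /itvP hq] := @rat_in_itvoo R (x ord0 i - ratr r) (x ord0 i + ratr r).
      by rewrite ltrD2l gt0_cp // re.
    by exists q; rewrite ltr_distl !hq.
  have [c hc] := choice hq.
  pose q : 'rV[rat]_k * rat := (\row_i c i, r).
  exists (pickle q) => //; rewrite /U pickleK.
  case: pselect => [_ i|]; first by rewrite /= mxE; exact: hc.
  case => y yq; apply: eA; apply/row_ballP; split => // i.
  have := yq i; rewrite /= mxE => yi.
  have := hc i; rewrite distrC => xi.
  apply: le_lt_trans (ler_distD (ratr (c i)) _ _) _.
  by rewrite (splitr e) ltrD // (lt_trans xi, lt_trans yi) // re.
apply: bigcupT_measurable => n; rewrite /U.
by case: unpickle => [q|]; [case: pselect => ?|]; [exact: mB|exact: measurable0|exact: measurable0].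
Qed.

Lemma closed_measurable_row k (A : set 'rV[R]_k) : closed A -> measurable A.
Proof. by move/closed_openC/open_measurable_row/measurableC; rewrite setCK. Qed.

Lemma continuous_measurable_row k (f : 'rV[R]_k -> R) :
  continuous f -> measurable_fun setT f.
Proof.
move=> /continuousP cf; apply: (measurability _ (RGenOpens.measurableE R)).
move=> _ [_ [a [b ->] <-]]; rewrite setTI; apply: open_measurable_row.
exact/cf/interval_open.
Qed.

(** Tonelli's theorem for the product defining the measure: the tool of the inductions on
the dimension. *)
Lemma ge0_integral_row_cons k (f : 'rV[R]_k.+1 -> \bar R) :
  measurable_fun [set: 'rV[R]_k.+1] f -> (forall x, 0 <= f x)%E ->
  (\int[lebesgue_row k.+1]_x f x =
   \int[@lebesgue_measure R]_t \int[lebesgue_row k]_y f (row_cons (t, y)))%E.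
Proof.
move=> mf f0.
rewrite [LHS](ge0_integral_pushforward (@measurable_row_cons R k)) //.
rewrite preimage_setT fubini_tonelli1 // => [|x]; last exact: f0.
exact: measurableT_comp mf (@measurable_row_cons R k).
Qed.

Lemma lebesgue_row_cube k (a b : R) : a <= b ->
  lebesgue_row k [set x : 'rV[R]_k | forall i, a <= x ord0 i <= b] =
  ((b - a) ^+ k)%:E.
Proof.
move=> ab; elim: k => [|k IH].
  by rewrite expr0 /= diracE mem_set //= => -[].
have -> : lebesgue_row k.+1 [set x : 'rV[R]_k.+1 | forall i, a <= x ord0 i <= b] =
    ((@lebesgue_measure R \x lebesgue_row k) (`[a, b]%classic `*`
    [set x : 'rV[R]_k | (forall i, a <= x ord0 i <= b)%R]))%E.
  rewrite /= /lebesgue_step /pushforward; congr (product_measure1 _ _ _).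
  apply/seteqP; split => [[t y] h|[t y] [/= ta h] i]; rewrite /row_cons ?mxE /=.
    split=> [|i] /=.
      by have := h ord0; rewrite /= mxE unlift_none /= in_itv.
    by have := h (lift ord0 i); rewrite /= mxE liftK.
  by move: ta; rewrite in_itv /=; case: unliftP => [j|] _ /=.
rewrite product_measure1E //; last first.
  apply: closed_measurable_row; rewrite (_ : mkset _ =
     \bigcap_(i in [set: 'I_k]) ((fun x : 'rV[R]_k => x ord0 i) @^-1` `[a, b]%classic)); last first.
    by apply/seteqP; split => x /= h i *; have := h i; rewrite /= in_itv /=; try exact.
  apply: closed_bigI => i _; apply: preimage_closed.
    by move=> x _; exact: coord_continuous.
  exact: interval_closed.
have hab : lebesgue_measure (`[a, b]%classic : set R) = (b - a)%:E.
  rewrite lebesgue_measure_itv /= lte_fin.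
  by case: ltgtP ab => [_ _|//|-> _]; rewrite ?subrr.
by rewrite IH [X in (X * _)%E]hab -EFinM exprS.
Qed.

(** Both sides are measures that agree on intervals. *)
Lemma lebesgue_measure_translate (h : R) (A : set R) : measurable A ->
  lebesgue_measure ((fun x => x + h) @^-1` A) = lebesgue_measure A.
Proof.
move=> mA.
have mh : measurable_fun [set: measurableTypeR R] (fun x : measurableTypeR R => x + h : measurableTypeR R).
  exact: measurable_funD.
rewrite [RHS](lebesgue_measure_unique (mu := (measure_function_pushforward__canonical__measure_function_Measure
    (@lebesgue_measure R) mh))) // => X [[a b] _ <-] /=.
rewrite /pushforward (_ : _ @^-1` _ = `]a - h, b - h]%classic); last first.
  by apply/seteqP; split => x /=; rewrite !in_itv /= ltrBlDr lerBrDr.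
rewrite !lebesgue_measure_itv /= !lte_fin ltrD2r; case: ifP => // _.
by rewrite -!EFinD; congr EFin; ring.
Qed.

Lemma ge0_integral_translate (h : R) (f : R -> \bar R) :
  measurable_fun setT f -> (forall x, 0 <= f x)%E ->
  (\int[@lebesgue_measure R]_x f (x + h)%R = \int[@lebesgue_measure R]_x f x)%E.
Proof.
move=> mf f0.
have mh : measurable_fun [set: measurableTypeR R] (fun x : measurableTypeR R => x + h : measurableTypeR R).
  exact: measurable_funD.
transitivity (\int[pushforward (@lebesgue_measure R) (fun x : measurableTypeR R => (x + h)%R : measurableTypeR R)]_x f x)%E.
  by rewrite (ge0_integral_pushforward mh).
apply: eq_measure_integral => A mA _.
exact: lebesgue_measure_translate.
Qed.

(** By induction on the dimension, the first coordinate being translated in the outer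
integral and the other ones in the inner integral. *)
Lemma ge0_integral_row_translate k (h : 'rV[R]_k) (f : 'rV[R]_k -> \bar R) :
  measurable_fun [set: 'rV[R]_k] f -> (forall x, 0 <= f x)%E ->
  (\int[lebesgue_row k]_x f (x + h)%R = \int[lebesgue_row k]_x f x)%E.
Proof.
elim: k h f => [|k IH] h f mf f0.
  by apply: eq_integral => x _; congr f; apply/rowP; case.
have mt j (g : 'rV[R]_j) : measurable_fun [set: 'rV[R]_j] (fun x : 'rV[R]_j => x + g).
  apply: measurable_fun_row => i.
  by under eq_fun do rewrite mxE; apply: measurable_funD => //; exact: measurable_coor.
have mfh : measurable_fun [set: 'rV[R]_k.+1] (fun x => f (x + h)).
  exact: measurableT_comp mf (mt _ h).
apply: (etrans (ge0_integral_row_cons mfh (fun x => f0 _))).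
apply: (etrans _ (esym (ge0_integral_row_cons mf f0))).
pose G t := (\int[lebesgue_row k]_y f (row_cons (t, y)))%E.
transitivity (\int[@lebesgue_measure R]_t G (t + h ord0 ord0)%R)%E.
  apply: eq_integral => t _.
  rewrite /G -[RHS](IH (\row_i h ord0 (lift ord0 i))) //.
    apply: eq_integral => y _; congr f; apply/rowP => i; rewrite !mxE.
    by case: unliftP => [j|] -> /=; rewrite ?mxE.
  apply: measurableT_comp => //.
  apply: measurableT_comp (@measurable_row_cons R k) _.
  exact: pair1_measurable.
apply: ge0_integral_translate => [|t]; last exact: integral_ge0.
apply: (measurable_fun_fubini_tonelli_F (fun z => f (row_cons z))) => //.
exact: measurableT_comp mf (@measurable_row_cons R k).
Qed.

End row_measure.

(** * Square-integrable functions *)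

Section L2_theory.
Context {R : realType} {k : nat}.
Implicit Types (D : set 'rV[R]_k) (u v : 'rV[R]_k -> R).
Local Notation mu := (lebesgue_row k).

Lemma finite_measure_bounded D (M : R) : measurable D ->
  (forall x, D x -> forall i, `|x ord0 i| <= M) -> (mu D < +oo)%E.
Proof.
move=> mD hM.
(* M may be negative, in which case D is empty or k = 0. *)
pose C := [set x : 'rV[R]_k | forall i, - `|M| <= x ord0 i <= `|M|].
have mC : measurable C.
  apply: closed_measurable_row; rewrite (_ : C =
     \bigcap_(i in [set: 'I_k]) ((fun x : 'rV[R]_k => x ord0 i) @^-1` `[- `|M|, `|M|]%classic)); last first.
    by apply/seteqP; split => x /= h i *; have := h i; rewrite /= in_itv /=; try exact.
  apply: closed_bigI => i _; apply: preimage_closed; last exact: interval_closed.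
  by move=> x _; exact: coord_continuous.
apply: (@le_lt_trans _ _ (mu C)).
  apply: le_measure; rewrite ?inE // => x Dx i.
  by rewrite -ler_norml (le_trans (hM x Dx i)) // ler_norm.
by rewrite lebesgue_row_cube ?ltry // (le_trans _ (normr_ge0 M)) // oppr_le0.
Qed.

Lemma patch_lin D c u v :
  (fun x => c * u x + v x) \_ D = c *: (u \_ D) + (v \_ D) :> ('rV[R]_k -> R).
Proof.
apply/funext => x; rewrite !fctE /patch; case: ifP => // _.
by rewrite scaler0 addr0.
Qed.

Lemma L2_lin D c u v : L2 D u -> L2 D v -> L2 D (fun x => c * u x + v x).
Proof.
by rewrite /L2 /= => hu hv; rewrite patch_lin; apply: (Lfun_submod_closed mu (lee1n 2)).2.
Qed.

Lemma L2_measurable D u : L2 D u -> measurable_fun [set: 'rV[R]_k] (u \_ D).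
Proof. by rewrite /L2 /= inE => /andP[/[!inE]]. Qed.

Lemma L2_finite D u : L2 D u -> ('N[mu]_2%:E[EFin \o (u \_ D)] < +oo)%E.
Proof. by rewrite /L2 /= inE => /andP[_ /[!inE]]. Qed.

Lemma L2P D u : measurable_fun [set: 'rV[R]_k] (u \_ D) ->
  ('N[mu]_2%:E[EFin \o (u \_ D)] < +oo)%E -> L2 D u.
Proof.
by move=> h1 h2; rewrite /L2 /= inE; apply/andP; split; rewrite inE.
Qed.

Lemma L2normE D u : L2 D u -> (L2norm D u)%:E = 'N[mu]_2%:E[EFin \o (u \_ D)]%E.
Proof. by move=> /L2_finite h; rewrite /L2norm fineK // ge0_fin_numE ?Lnorm_ge0. Qed.

Lemma L2norm_ge0 D u : 0 <= L2norm D u.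
Proof. by rewrite fine_ge0 // Lnorm_ge0. Qed.

Lemma L2normD D u v : L2 D u -> L2 D v ->
  L2norm D (fun x => u x + v x) <= L2norm D u + L2norm D v.
Proof.
move=> hu hv.
have huv : L2 D (fun x => u x + v x).
  by have := L2_lin 1 hu hv; under eq_fun do rewrite mul1r.
rewrite -lee_fin EFinD !L2normE // (_ : (fun x => u x + v x) \_ D = (u \_ D) \+ (v \_ D)).
  by apply: minkowski_EFin; [exact: L2_measurable|exact: L2_measurable|rewrite ler1n].
by apply/funext => x; rewrite /= /patch; case: ifP => // _; rewrite addr0.
Qed.

Lemma L2normZ D c u : L2 D u -> L2norm D (fun x => c * u x) = `|c| * L2norm D u.
Proof.
move=> hu.
(* c u is (c - 1) u + u. *)
have hu' : L2 D (fun x => c * u x).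
  have := L2_lin (c - 1) hu hu.
  by under eq_fun do rewrite mulrBl mul1r subrK.
apply: EFin_inj; rewrite EFinM !L2normE // -(LnormZ (Lfun_Sub (lee1n 2) hu)).
congr Lnorm; apply/funext => x; rewrite /= /patch; case: ifP => // _.
by rewrite scaler0.
Qed.

Lemma eq_L2norm D u v : (forall x, D x -> u x = v x) -> L2norm D u = L2norm D v.
Proof.
move=> uv; rewrite /L2norm (_ : u \_ D = v \_ D) //.
by apply/funext => x; rewrite /patch; case: ifPn => // /[!inE]; exact: uv.
Qed.

Lemma L2norm0 D : L2norm D (fun=> 0) = 0.
Proof.
rewrite /L2norm (_ : _ \_ D = cst 0); first by rewrite (Lnorm0 mu) // eqe pnatr_eq0.
by apply/funext => x; rewrite /patch; case: ifP.
Qed.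

Lemma ae_L2norm0 D u : measurable D -> L2 D u -> u = (fun=> 0) %[ae mu in D] ->
  L2norm D u = 0.
Proof.
move=> mD hu u0; apply: EFin_inj; rewrite L2normE // unlock /=.
rewrite (ae_eq_integral (cst 0%E)) // ?integral0 ?poweR0r ?invr_eq0 ?pnatr_eq0 //.
  apply/measurable_EFinP; apply: (@measurableT_comp _ _ _ _ _ _ (@powR R ^~ 2)) => //.
  apply: measurableT_comp => //; exact: L2_measurable.
apply: filterS u0 => x h _; rewrite /= /patch; case: ifPn => [/[!inE] /h -> |_];
  by rewrite normr0 powR0 // pnatr_eq0.
Qed.

Lemma L2_bounded D u (M : R) : measurable D -> (mu D < +oo)%E ->
  measurable_fun [set: 'rV[R]_k] u -> (forall x, D x -> `|u x| <= M) -> L2 D u.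
Proof.
move=> mD Dfin mu_ hM.
have muD : measurable_fun [set: 'rV[R]_k] (u \_ D).
  by apply/measurable_restrict => //; rewrite setTI; exact: measurable_funTS.
apply: L2P => //; rewrite unlock poweR_lty //.
apply: (@le_lt_trans _ _ (\int[mu]_(x in D) (cst (M ^+ 2)%:E x))%E).
  rewrite [leRHS]integral_mkcond; apply: ge0_le_integral => //.
  - by move=> x _; rewrite poweR_ge0.
  - apply/measurable_EFinP; apply: (@measurableT_comp _ _ _ _ _ _ (@powR R ^~ 2)) => //.
    exact: measurableT_comp.
  - by apply/measurable_restrict => //; rewrite setTI.
  move=> x _; rewrite /= /patch; case: ifPn => [/[!inE] Dx|_].
    by rewrite lee_fin powR_mulrn // lerXn2r ?nnegrE // ?hM // (le_trans _ (hM _ Dx)).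
  by rewrite normr0 powR0 // pnatr_eq0.
by rewrite integral_cst // lte_mul_pinfty // lee_fin sqr_ge0.
Qed.

Lemma L2_mul_integrable D u v : measurable D -> L2 D u -> L2 D v ->
  mu.-integrable D (EFin \o (fun x => u x * v x)).
Proof.
move=> mD hu hv.
have /Lfun1_integrable := Lfun2_mul_Lfun1 hu hv.
move=> h; rewrite -[X in _.-integrable X _]setTI.
apply/(integrable_restrict mu mD measurableT).
apply: eq_integrable h => // x _; rewrite /= /patch; case: ifP => // _.
by rewrite mul0r.
Qed.

Lemma L2_cst D c : measurable D -> (mu D < +oo)%E -> L2 D (fun=> c).
Proof. by move=> mD Dfin; apply: (@L2_bounded _ _ `|c|). Qed.

Lemma L2_integrable D u : measurable D -> (mu D < +oo)%E -> L2 D u ->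
  mu.-integrable D (EFin \o u).
Proof.
move=> mD Dfin hu; have := L2_mul_integrable mD hu (L2_cst 1 mD Dfin).
by apply: eq_integrable => // x _ /=; rewrite mulr1.
Qed.

(** The Cauchy-Schwarz inequality against the constant 1. *)
Lemma L1_le_L2norm D u : measurable D -> (mu D < +oo)%E -> L2 D u ->
  (\int[mu]_(x in D) `|u x|%:E <= (L2norm D u * L2norm D (fun=> 1))%:E)%E.
Proof.
move=> mD Dfin hu; have h1 := L2_cst 1 mD Dfin.
have h22 : (2^-1 + 2^-1 = 1 :> R)%R by rewrite [RHS]splitr !div1r.
have := hoelder mu (L2_measurable hu) (L2_measurable h1) (ltr0n _ 2) (ltr0n _ 2) h22.
rewrite -!L2normE // -EFinM; apply: le_trans.
rewrite Lnorm1 [leLHS]integral_mkcond; apply: ge0_le_integral => //.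
- by move=> x _; apply: erestrict_ge0.
- rewrite (_ : _ \_ D = EFin \o (Num.norm \o (u \_ D))).
    by apply/measurable_EFinP/measurableT_comp => //; exact: L2_measurable.
  by apply/funext => x; rewrite /= /patch; case: ifP => // _; rewrite normr0.
- apply/measurable_EFinP; apply: measurableT_comp => //; apply: measurable_funM; exact: L2_measurable.
- by move=> x _; rewrite /= /patch; case: ifP => _; [rewrite mulr1|rewrite lee_fin normr_ge0].
Qed.

End L2_theory.

(** * Functions of class C1 *)

Section paths.
Context {R : realType} {n : nat}.
Implicit Types (w : 'rV[R]_n.+1 -> R) (x y v : 'rV[R]_n.+1).

Lemma path_is_derive w y v (s : R) : derivable w (y + s *: v) v ->
  is_derive s 1 (fun t => w (y + t *: v)) ('D_v w (y + s *: v)).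
Proof.
move=> dw.
have E : (fun h : R => h^-1 *: ((fun t => w (y + t *: v)) (h *: 1 + s) - w (y + s *: v))) =
    (fun h : R => h^-1 *: (w (h *: v + (y + s *: v)) - w (y + s *: v))).
  apply/funext => h; congr (_ *: (w _ - _)).
  by rewrite (_ : h%:A = h) ?scalerDl 1?addrCA //; exact: mulr1.
split; rewrite /derivable /derive /=.
  by rewrite [X in cvg (X @ _)]E.
by rewrite [X in lim (X @ _)]E.
Qed.

Lemma partial_mean_value w b y (t : R) :
  (forall x, derivable w x (delta_mx ord0 b)) ->
  exists2 xi, `|xi| <= `|t| & w (y + t *: delta_mx ord0 b) - w y =
    t * partial b w (y + xi *: delta_mx ord0 b).
Proof.
move=> dw; set e := delta_mx ord0 b.
pose p s := w (y + s *: e).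
have dp (s : R) : is_derive s 1 p (partial b w (y + s *: e)) by exact/path_is_derive.
have cp : continuous p.
  by move=> s; apply/differentiable_continuous/derivable1_diffP; case: (dp s).
have [t0|t0] := leP 0 t.
  have [//|c ct E] := @MVT_segment R p (fun s => partial b w (y + s *: e)) 0 t t0 (fun r _ => dp r).
    exact: continuous_subspaceT.
  exists c; first by move: ct; rewrite in_itv /= => /andP[c0 ct]; rewrite !ger0_norm.
  by move: E; rewrite /p scale0r addr0 subr0 mulrC.
have [//|c ct E] := @MVT_segment R p (fun s => partial b w (y + s *: e)) t 0 (ltW t0) (fun r _ => dp r).
  exact: continuous_subspaceT.
exists c.
  by move: ct; rewrite in_itv /= => /andP[ct c0]; rewrite !ler0_norm ?lerN2 // ltW.
move: E; rewrite /p scale0r addr0 => E; lra.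
Qed.

Definition C1 w : Prop := continuous w /\
  forall b, (forall x, derivable w x (delta_mx ord0 b)) /\ continuous (partial b w).

Lemma smooth_C1 w : smooth w -> C1 w.
Proof.
move=> sw; split; first exact: (sw [::]).1.
by move=> b; split; [move=> x; exact: (sw [::]).2|exact: (sw [:: b]).1].
Qed.

Lemma row_normP (x : 'rV[R]_n.+1) (M : R) : `|x| <= M <-> forall i, `|x ord0 i| <= M.
Proof.
rewrite [`|x|]mx_normrE; split=> [h i|h].
  apply: le_trans h; apply: (le_trans _ (le_bigmax _ _ (ord0, i))) => //.
apply/bigmax_leP; split => [|[i j] _ /=]; first by rewrite (le_trans _ (h ord0)).
by rewrite (ord1 i).
Qed.

(** Going from x to x + h v by changing one coordinate at a time, the mean value theorem
bounds each step with the continuity of one partial derivative. *)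
Lemma C1_derive w x v : C1 w ->
  is_derive x v w (\sum_b v ord0 b * partial b w x).
Proof.
move=> [cw dw].
suff h : (fun h : R => h^-1 *: (w (h *: v + x) - w x)) @ 0^' --> \sum_b v ord0 b * partial b w x.
  by split; [exact: cvgP h|exact: cvg_lim h].
apply/cvgrPdist_le => e e0.
pose V := 1 + \sum_b `|v ord0 b|.
have V0 : 0 < V by rewrite ltr_pwDl // sumr_ge0.
have eV0 : 0 < e / V by rewrite divr_gt0.
have hd : \forall y \near x, forall b, `|partial b w x - partial b w y| <= e / V.
  apply: (@filter_forall _ 'I_n.+1 (fun b y => `|partial b w x - partial b w y| <= e / V) (nbhs x)) => b.
  by move: ((dw b).2 x) => /cvgrPdist_le/(_ _ eV0).
have /nbhs_ballP[d /= d0 hd'] := hd.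
near=> h.
have h0 : h != 0 by near: h; exact: nbhs_dnbhs_neq.
have hv b : `|h * v ord0 b| < d.
  have hV : `|h| * V < d.
    rewrite -ltr_pdivlMr //; near: h; apply: dnbhs0_lt; exact: divr_gt0.
  apply: le_lt_trans hV; rewrite normrM ler_wpM2l //.
  rewrite /V (bigD1 b) //= addrCA lerDl addr_ge0 // sumr_ge0 //.
(* z goes from x to x + h v by moving the coordinates one by one. *)
pose z (j : nat) : 'rV[R]_n.+1 := \row_b (x ord0 b + (if (b < j)%N then h * v ord0 b else 0)).
have zS (j : 'I_n.+1) : z j.+1 = z j + (h * v ord0 j) *: delta_mx ord0 j.
  apply/rowP => b; rewrite !mxE eqxx /= ltnS [(b <= j)%N]leq_eqVlt.
  have [->|bj] := eqVneq b j; first by rewrite eqxx ltnn /= mulr1 addr0.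
  by have /negbTE -> : b != j :> nat by []; rewrite mulr0 addr0.
have step (j : 'I_n.+1) : `|w (z j.+1) - w (z j) - h * v ord0 j * partial j w x| <=
   `|h| * `|v ord0 j| * (e / V).
  have [xi xile E] := partial_mean_value (z j) (h * v ord0 j) (dw j).1.
  rewrite zS E -mulrBr normrM (normrM h) ler_wpM2l ?mulr_ge0 //.
  rewrite distrC; apply: hd'; apply/row_ballP; split => // b.
  rewrite !mxE eqxx /= opprD addrA opprD addrA subrr add0r.
  have [->|bj] := eqVneq b j.
    by rewrite ltnn oppr0 mulr1 sub0r normrN (le_lt_trans xile).
  rewrite mulr0 subr0 normrN; case: ifP => _ //; by rewrite normr0.
have z0 : z 0%N = x by apply/rowP => b; rewrite mxE addr0.
have zn : z n.+1 = h *: v + x by apply/rowP => b; rewrite !mxE ltn_ord addrC.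
have tele : w (h *: v + x) - w x - h * \sum_b v ord0 b * partial b w x =
   \sum_(j < n.+1) (w (z j.+1) - w (z j) - h * v ord0 j * partial j w x).
  rewrite sumrB -(big_mkord predT (fun j => w (z j.+1) - w (z j))) telescope_sumr // zn z0.
  by rewrite mulr_sumr; congr (_ - _); apply: eq_bigr => b _; rewrite mulrA.
rewrite distrC.
have -> : h^-1 *: (w (h *: v + x) - w x) - \sum_b v ord0 b * partial b w x =
   h^-1 * (w (h *: v + x) - w x - h * \sum_b v ord0 b * partial b w x).
  by rewrite mulrBr mulrA mulVf // mul1r.
rewrite normrM normfV ler_pdivrMl ?normr_gt0 // tele.
apply: le_trans (ler_norm_sum _ _ _) _.
apply: le_trans (ler_sum _ (fun j _ => step j)) _.
rewrite -mulr_suml -mulr_sumr -mulrA ler_wpM2l // mulrCA ler_piMr ?ltW //.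
by rewrite ltr_pdivrMr // mul1r /V ltrDr ltr01.
Unshelve. all: by end_near. Qed.

End paths.

(** * Increments of a function of class C1 *)

Section translations.
Context {R : realType} {n : nat}.
Implicit Types (w u f : 'rV[R]_n.+1 -> R) (x y v h : 'rV[R]_n.+1) (K : set 'rV[R]_n.+1).
Local Notation mu := (lebesgue_row n.+1).
Local Notation leb := (@lebesgue_measure R).
Local Notation I01 := (`[0%R, 1%R]%classic : set (measurableTypeR R)).

Lemma path_continuous f x v : continuous f -> continuous (fun s : R => f (x + s *: v)).
Proof.
move=> cf s; apply: continuous_comp; last exact: cf.
apply: cvgD; first exact: cvg_cst.
by apply: cvgZr_tmp; exact: cvg_id.
Qed.

Lemma path_FTC w x v : (forall y, derivable w y v) -> continuous ('D_v w) ->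
  (\int[leb]_(s in `[0%R, 1%R]) ('D_v w (x + s *: v))%:E = (w (x + v) - w x)%:E)%E.
Proof.
move=> dw cdw.
have dp (s : R) : is_derive s 1 (fun t => w (x + t *: v)) ('D_v w (x + s *: v)).
  exact: path_is_derive.
have cp : continuous (fun t : R => w (x + t *: v)).
  by move=> s; apply/differentiable_continuous/derivable1_diffP; case: (dp s).
have c1 : continuous (fun s : R => 'D_v w (x + s *: v)) := path_continuous cdw.
rewrite (@continuous_FTC2 R (fun s => 'D_v w (x + s *: v)) (fun t => w (x + t *: v))) //.
- by rewrite scale1r scale0r addr0.
- exact: continuous_subspaceT.
- split; first by move=> s _; case: (dp s).
  + by apply: cvg_at_right_filter; exact: cp.
  + by apply: cvg_at_left_filter; exact: cp.
- by move=> s _; rewrite derive1E; case: (dp s).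
Qed.

Lemma measurable_segment v : measurable_fun [set: measurableTypeR R * 'rV[R]_n.+1]
  (fun z => z.2 + (z.1 : R) *: v).
Proof.
apply: measurable_fun_row => i.
under eq_fun do rewrite !mxE.
apply: measurable_funD; last by apply: measurable_funM.
exact: (measurableT_comp (measurable_coor i)).
Qed.

Lemma measurable_addr h : measurable_fun [set: 'rV[R]_n.+1] (fun x => x + h).
Proof.
apply: measurable_fun_row => i.
by under eq_fun do rewrite mxE; apply: measurable_funD => //; exact: measurable_coor.
Qed.

(** Exchange the integrals: all the translates of g have the same integral, and the
segment of parameters has length 1. *)
Lemma ge0_integral_segment (g : 'rV[R]_n.+1 -> R) v :
  measurable_fun [set: 'rV[R]_n.+1] g -> (forall x, 0 <= g x) ->
  (\int[mu]_x \int[leb]_(s in I01) (g (x + s *: v))%:E = \int[mu]_x (g x)%:E)%E.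
Proof.
move=> mg g0.
pose F (z : measurableTypeR R * 'rV[R]_n.+1) : \bar R := (\1_I01 z.1 * g (z.2 + (z.1 : R) *: v))%:E.
have mF : measurable_fun [set: measurableTypeR R * 'rV[R]_n.+1] F.
  apply/measurable_EFinP; apply: measurable_funM.
    by apply: (measurableT_comp (measurable_indic _)).
  exact: (measurableT_comp mg (measurable_segment v)).
have F0 z : (0 <= F z)%E by rewrite lee_fin mulr_ge0.
have := @fubini_tonelli _ _ _ _ _ leb mu F mF F0.
have indic_int (f : R -> R) : (\int[leb]_s (\1_I01 s * f s)%:E = \int[leb]_(s in I01) (f s)%:E)%E.
  rewrite [RHS]integral_mkcond; apply: eq_integral => s _; rewrite /= patchE indicE.
  by case: ifP => _; rewrite ?mul1r ?mul0r.
under [in X in _ = X -> _]eq_integral do rewrite /F /= indic_int.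
move=> <-.
transitivity (\int[leb]_(s in I01) \int[mu]_x (g x)%:E)%E.
  rewrite [RHS]integral_mkcond; apply: eq_integral => s _; rewrite /F /= patchE indicE.
  case: ifP => _.
    under eq_integral do rewrite mul1r.
    apply: (ge0_integral_row_translate (s *: v) (f := EFin \o g)) => //.
      exact/measurable_EFinP.
  by under eq_integral do rewrite mul0r; rewrite integral0.
have l01 : leb I01 = 1%E.
  by rewrite /= lebesgue_measure_itv /= lte_fin ltr01 oppr0 adde0.
by rewrite integral_cst // [X in (_ * X)%E]l01 mule1.
Qed.

(** The second endpoint is given by its difference v with the first one, since segments
are used below as translates of a point. *)
Definition convex_set K := forall x v, K x -> K (x + v) ->
  forall s : R, 0 <= s <= 1 -> K (x + s *: v).

(** The increment w (x + h) - w x is the integral of the derivative of w along a segment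
that stays in K by convexity; averaging over x makes the position on the segment
irrelevant. *)
Lemma translation_bound w h K : measurable K -> convex_set K -> C1 w ->
  (\int[mu]_x (\1_K x * \1_K (x + h) * `|w (x + h) - w x|)%:E <=
   \int[mu]_(x in K) `|'D_h w x|%:E)%E.
Proof.
move=> mK cK C1w.
have dw y : derivable w y h by case: (C1_derive y h C1w).
have cdw : continuous ('D_h w).
  have -> : 'D_h w = (fun x => \sum_b h ord0 b * partial b w x).
    by apply/funext => x; case: (C1_derive x h C1w).
  apply: continuous_big => [|b _ x]; last first.
    by apply: (@continuousM _ _ (fun=> h ord0 b) (partial b w)); [exact: cst_continuous|exact: (C1w.2 b).2].
  exact: add_continuous.
have mdw := continuous_measurable_row cdw.
have mw := continuous_measurable_row C1w.1.
pose g x := \1_K x * `|'D_h w x|.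
have mg : measurable_fun [set: 'rV[R]_n.+1] g.
  by apply: measurable_funM; [exact: measurable_indic|exact: measurableT_comp].
have g0 x : 0 <= g x by rewrite mulr_ge0.
have -> : (\int[mu]_(x in K) `|'D_h w x|%:E = \int[mu]_x (g x)%:E)%E.
  rewrite integral_mkcond; apply: eq_integral => x _; rewrite /= patchE /g indicE.
  by case: ifP => _; rewrite ?mul1r ?mul0r.
rewrite -[leRHS](ge0_integral_segment h mg g0).
apply: ge0_le_integral => //.
- apply/measurable_EFinP; apply: measurable_funM.
    apply: measurable_funM; first exact: measurable_indic.
    by apply: (measurableT_comp (measurable_indic mK)); exact: measurable_addr.
  apply: measurableT_comp => //; apply: measurable_funB => //.
  by apply: (measurableT_comp mw); exact: measurable_addr.
- pose F (z : measurableTypeR R * 'rV[R]_n.+1) : \bar R := (\1_I01 z.1 * g (z.2 + (z.1 : R) *: h))%:E.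
  have mF : measurable_fun [set: measurableTypeR R * 'rV[R]_n.+1] F.
    apply/measurable_EFinP; apply: measurable_funM.
      by apply: (measurableT_comp (measurable_indic _)).
    exact: (measurableT_comp mg (measurable_segment h)).
  have F0 z : (0 <= F z)%E by rewrite lee_fin mulr_ge0.
  have := measurable_fun_fubini_tonelli_G (m1 := leb) F mF F0.
  apply: eq_measurable_fun => x _; rewrite /fubini_G.
  rewrite [RHS]integral_mkcond; apply: eq_integral => s _; rewrite /F /= patchE indicE.
  by case: ifP => _; rewrite ?mul1r ?mul0r.
move=> x _.
have [Kx|Kx] := boolP (x \in K); last first.
  by rewrite indicE (negbTE Kx) !mul0r; apply: integral_ge0 => s _; rewrite lee_fin.
have [Kxh|Kxh] := boolP (x + h \in K); last first.
  by rewrite [X in _ * X * _]indicE (negbTE Kxh) mulr0 mul0r; apply: integral_ge0 => s _; rewrite lee_fin.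
rewrite !indicE Kx Kxh !mul1r -abse_EFin -path_FTC //.
have mp : measurable_fun [set: measurableTypeR R] (fun s : measurableTypeR R => 'D_h w (x + s *: h)).
  have c1 : continuous (fun s : R => 'D_h w (x + s *: h)) := path_continuous cdw.
  exact: (continuous_measurable_fun c1).
apply: le_trans (le_abse_integral _ _ _) _ => //.
  by apply/measurable_EFinP; exact: measurable_funTS.
apply: ge0_le_integral => //.
- by apply/measurable_EFinP; apply: measurableT_comp => //; exact: measurable_funTS.
- apply/measurable_EFinP; apply: measurable_funTS.
  apply: (measurableT_comp mg); apply: measurable_fun_row => i.
  under eq_fun do rewrite !mxE.
  by apply: measurable_funD => //; apply: measurable_funM.
move=> s /= s01; rewrite lee_fin /g indicE mem_set ?mul1r //.
by apply: cK; [exact: set_mem|exact: set_mem|move: s01; rewrite in_itv].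
Qed.

End translations.

(** * Functions invariant under translation *)

Section constancy.
Context {R : realType} {n : nat}.
Implicit Types (w u f : 'rV[R]_n.+1 -> R) (x y v h : 'rV[R]_n.+1) (K : set 'rV[R]_n.+1).
Local Notation mu := (lebesgue_row n.+1).
Local Notation leb := (@lebesgue_measure R).

Lemma ge0_integral_indic K f : measurable K -> 
  (\int[mu]_x (\1_K x * f x)%:E = \int[mu]_(x in K) (f x)%:E)%E.
Proof.
move=> mK; rewrite [RHS]integral_mkcond; apply: eq_integral => x _.
by rewrite /= patchE indicE; case: ifP => _; rewrite ?mul1r ?mul0r.
Qed.

Lemma integral_row_translate h (f : 'rV[R]_n.+1 -> \bar R) :
  measurable_fun [set: 'rV[R]_n.+1] f ->
  (\int[mu]_x f (x + h)%R = \int[mu]_x f x)%E.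
Proof.
move=> mf; rewrite integralE [RHS]integralE; congr (_ - _)%E.
  have mp := measurable_funepos mf.
  transitivity (\int[mu]_x (f^\+ (x + h)%R))%E.
    by apply: eq_integral => x _; rewrite unlock.
  by apply: (ge0_integral_row_translate h mp).
have mn := measurable_funeneg mf.
transitivity (\int[mu]_x (f^\- (x + h)%R))%E.
    by apply: eq_integral => x _; rewrite unlock.
  by apply: (ge0_integral_row_translate h mn).
Qed.

(** Integrating over h and exchanging the integrals, U y = U x for almost every pair (x, y)
of points of K, hence for almost every y when x is well chosen. *)
Lemma translation_invariant_cst K (U : 'rV[R]_n.+1 -> R) :
  measurable K -> measurable_fun [set: 'rV[R]_n.+1] U ->
  (forall h, \int[mu]_x (\1_K x * \1_K (x + h) * `|U (x + h) - U x|)%:E = 0)%E ->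
  exists c, U = (fun=> c) %[ae mu in K].
Proof.
move=> mK mU U0.
pose g x y := \1_K x * (\1_K y * `|U y - U x|).
(* The first component of z is the translation h, the second one is x. *)
pose F (z : 'rV[R]_n.+1 * 'rV[R]_n.+1) : \bar R := (g z.2 (z.1 + z.2))%:E.
have madd : measurable_fun [set: 'rV[R]_n.+1 * 'rV[R]_n.+1] (fun z => z.1 + z.2).
  apply: measurable_fun_row => i; under eq_fun do rewrite mxE.
  by apply: measurable_funD; apply: (measurableT_comp (measurable_coor i)).
have mF : measurable_fun [set: 'rV[R]_n.+1 * 'rV[R]_n.+1] F.
  apply/measurable_EFinP; apply: measurable_funM.
    by apply: (measurableT_comp (measurable_indic mK)).
  apply: measurable_funM; first exact: (measurableT_comp (measurable_indic mK)).
  apply: measurableT_comp => //; apply: measurable_funB; first exact: (measurableT_comp mU).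
  exact: (measurableT_comp mU).
have F0 z : (0 <= F z)%E by rewrite lee_fin !mulr_ge0.
have := @fubini_tonelli _ _ _ _ _ mu mu F mF F0.
have -> : (\int[mu]_h \int[mu]_x F (h, x) = 0)%E.
  rewrite -[RHS](integral0 mu setT); apply: eq_integral => h _.
  rewrite -[RHS](U0 h); apply: eq_integral => x _.
  by rewrite /F /g /= [h + x]addrC mulrA.
pose phi x := (\int[mu]_y (\1_K y * `|U y - U x|)%:E)%E.
have mphi : measurable_fun [set: 'rV[R]_n.+1] phi.
  pose G (z : 'rV[R]_n.+1 * 'rV[R]_n.+1) : \bar R := (\1_K z.2 * `|U z.2 - U z.1|)%:E.
  apply: (@measurable_fun_fubini_tonelli_F _ _ _ _ _ mu G) => [|z]; last by rewrite lee_fin mulr_ge0.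
  apply/measurable_EFinP; apply: measurable_funM.
    by apply: (measurableT_comp (measurable_indic mK)).
  apply: measurableT_comp => //; apply: measurable_funB; exact: (measurableT_comp mU).
have phi0 x : (0 <= phi x)%E by apply: integral_ge0 => y _; rewrite lee_fin mulr_ge0.
have mh x : measurable_fun [set: 'rV[R]_n.+1] (fun y => \1_K y * `|U y - U x|).
  apply: measurable_funM; first exact: measurable_indic.
  by apply: measurableT_comp => //; apply: measurable_funB.
have -> : (\int[mu]_x \int[mu]_h F (h, x) = \int[mu]_(x in K) phi x)%E.
  rewrite [RHS]integral_mkcond; apply: eq_integral => x _; rewrite /= patchE /F /g /= indicE.
  case: ifP => _; last first.
    by under eq_integral do rewrite mul0r; rewrite integral0.
  under eq_integral do rewrite mul1r.
  rewrite /phi -[RHS](ge0_integral_row_translate x) //; first exact/measurable_EFinP.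
move=> /esym phiK.
have phi_ae : ae_eq mu K phi (cst 0%E).
  apply/(ae_eq_integral_abs _ mK) => //; first exact: measurable_funTS.
  by rewrite -[RHS]phiK; apply: eq_integral => x _; rewrite gee0_abs.
have [K0|K0] := eqVneq (mu K) 0%E.
  exists 0; exists K; split => // x /=; by apply: contra_notP => Kx h.
have [x [Kx phix]] : exists x, K x /\ phi x = 0%E.
  apply: contrapT => /forallNP H.
  case: phi_ae => N [mN N0 hN].
  move/eqP: K0; apply; apply: (subset_measure0 mK mN) => // x Kx.
  apply: hN => /= h; apply: (H x); split => //; exact: h.
exists (U x).
have : ae_eq mu setT (fun y => (\1_K y * `|U y - U x|)%:E) (cst 0%E).
  apply/(ae_eq_integral_abs _ measurableT) => //; first exact/measurable_EFinP.
  by rewrite -[RHS]phix; apply: eq_integral => y _; rewrite gee0_abs // lee_fin mulr_ge0.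
apply: filterS => y /(_ I) [] + Ky.
by rewrite indicE mem_set // mul1r => /eqP; rewrite normr_eq0 subr_eq0 => /eqP.
Qed.

(** The bound on the increments of w j passes to the limit, since u is close to w j in L^1
at x as well as at x + h. *)
Lemma gradient_limit0_cst K u (w : nat -> 'rV[R]_n.+1 -> R) :
  measurable K -> (mu K < +oo)%E -> convex_set K ->
  L2 K u -> (forall j, C1 (w j)) ->
  (forall j, L2 K (w j)) -> (forall j b, L2 K (partial b (w j))) ->
  L2norm K (fun x => w j x - u x) @[j --> \oo] --> (0 : R) ->
  (forall b, L2norm K (partial b (w j)) @[j --> \oo] --> (0 : R)) ->
  exists c, u = (fun=> c) %[ae mu in K].
Proof.
move=> mK Kfin cK uL2 C1w wL2 dwL2 wu dw0.
pose U := u \_ K.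
have mU : measurable_fun [set: 'rV[R]_n.+1] U by exact: L2_measurable.
have UE x : K x -> U x = u x by move=> Kx; rewrite /U patchE mem_set.
suff [c hc] : exists c, U = (fun=> c) %[ae mu in K].
  by exists c; apply: filterS hc => x h Kx; rewrite -UE // h.
apply: translation_invariant_cst => // h.
have mind v : measurable_fun [set: 'rV[R]_n.+1] (fun x => \1_K (x + v) : R).
  exact: (measurableT_comp (measurable_indic mK) (measurable_addr v)).
have mwj j := continuous_measurable_row (C1w j).1.
have mw j v : measurable_fun [set: 'rV[R]_n.+1] (fun x => w j (x + v)).
  exact: (measurableT_comp (mwj j) (measurable_addr v)).
have mUv v : measurable_fun [set: 'rV[R]_n.+1] (fun x => U (x + v)).
  exact: (measurableT_comp mU (measurable_addr v)).
pose one := L2norm K (fun=> 1).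
pose del j := L2norm K (fun x => w j x - u x).
have wuL2 j : L2 K (fun x => w j x - u x).
  have := L2_lin (-1) uL2 (wL2 j); under eq_fun do rewrite mulN1r addrC.
  by [].
have d1 j : (\int[mu]_x (\1_K x * `|U x - w j x|)%:E <= (del j * one)%:E)%E.
  rewrite ge0_integral_indic //; apply: le_trans (L1_le_L2norm mK Kfin (wuL2 j)).
  by rewrite le_eqVlt; apply/orP; left; apply/eqP; apply: eq_integral => x /[!inE] Kx; rewrite UE // distrC.
have d2 j : (\int[mu]_x (\1_K (x + h) * `|U (x + h) - w j (x + h)%R|)%:E <= (del j * one)%:E)%E.
  apply: le_trans (d1 j).
  rewrite (ge0_integral_row_translate h (f := fun x => (\1_K x * `|U x - w j x|)%:E)) //.
    apply/measurable_EFinP; apply: measurable_funM; first exact: measurable_indic.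
    by apply: measurableT_comp => //; exact: measurable_funB.
have hdw j x : 'D_h (w j) x = \sum_b h ord0 b * partial b (w j) x.
  by case: (C1_derive x h (C1w j)).
have d3 j : (\int[mu]_(x in K) `|'D_h (w j) x|%:E <=
    (\sum_b `|h ord0 b| * (L2norm K (partial b (w j)) * one))%:E)%E.
  apply: (@le_trans _ _ (\int[mu]_(x in K) \sum_b (`|h ord0 b|%:E * `|partial b (w j) x|%:E))%E).
    apply: ge0_le_integral => //.
    - apply/measurable_EFinP; apply: measurableT_comp => //; apply: measurable_funTS.
      rewrite (_ : 'D_h (w j) = (fun x => \sum_b h ord0 b * partial b (w j) x)); last exact/funext.
      apply: measurable_sum => b; apply: measurable_funM => //.
      exact: (continuous_measurable_row ((C1w j).2 b).2).
    - apply: emeasurable_sum => b _; apply: emeasurable_funM => //.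
      apply/measurable_EFinP; apply: measurableT_comp => //; apply: measurable_funTS.
      exact: (continuous_measurable_row ((C1w j).2 b).2).
    move=> x _; rewrite hdw.
    rewrite [X in (_ <= X)%E](_ : _ = (\sum_b `|h ord0 b| * `|partial b (w j) x|)%:E);
      last by rewrite -sumEFin.
    rewrite lee_fin; apply: le_trans (ler_norm_sum _ _ _) _.
    by apply: ler_sum => b _; rewrite normrM.
  rewrite ge0_integral_sum //; last first.
    move=> b; apply: emeasurable_funM => //.
    apply/measurable_EFinP; apply: measurableT_comp => //; apply: measurable_funTS.
    exact: (continuous_measurable_row ((C1w j).2 b).2).
  rewrite -sumEFin; apply: lee_sum => b _.
  rewrite ge0_integralZl //; last first.
    apply/measurable_EFinP; apply: measurableT_comp => //; apply: measurable_funTS.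
    exact: (continuous_measurable_row ((C1w j).2 b).2).
  rewrite EFinM lee_wpmul2l //.
  exact: L1_le_L2norm.
(* The distance from u to w j at x + h, the increment of w j, and the distance
   from w j to u at x. *)
pose bound j := del j * one + (\sum_b `|h ord0 b| * (L2norm K (partial b (w j)) * one)) + del j * one.
have hb j : (\int[mu]_x (\1_K x * \1_K (x + h) * `|U (x + h) - U x|)%:E <= (bound j)%:E)%E.
  have := translation_bound h mK cK (C1w j).
  move=> /le_trans/(_ (d3 j)) d4.
  rewrite /bound !EFinD; apply: le_trans (leeD (leeD (d2 j) d4) (d1 j)).
  have m1 : measurable_fun [set: 'rV[R]_n.+1] (fun x => \1_K (x + h) * `|U (x + h) - w j (x + h)|).
    by apply: measurable_funM => //; apply: measurableT_comp => //; exact: measurable_funB.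
  have m2 : measurable_fun [set: 'rV[R]_n.+1] (fun x => \1_K x * \1_K (x + h) * `|w j (x + h) - w j x|).
    apply: measurable_funM; last by apply: measurableT_comp => //; exact: measurable_funB.
    by apply: measurable_funM => //; exact: measurable_indic.
  have m3 : measurable_fun [set: 'rV[R]_n.+1] (fun x => \1_K x * `|U x - w j x|).
    by apply: measurable_funM => //; apply: measurableT_comp => //; exact: measurable_funB.
  have m4 : measurable_fun [set: 'rV[R]_n.+1] (fun x => \1_K x * \1_K (x + h) * `|U (x + h) - U x|).
    apply: measurable_funM; last by apply: measurableT_comp => //; exact: measurable_funB.
    by apply: measurable_funM => //; exact: measurable_indic.
  rewrite -ge0_integralD //; try exact/measurable_EFinP.
  rewrite -ge0_integralD //; try exact/measurable_EFinP;
    try (by apply: emeasurable_funD; exact/measurable_EFinP);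
    try (by move=> x _; rewrite -EFinD lee_fin).
  apply: ge0_le_integral => //; try exact/measurable_EFinP.
    by apply: emeasurable_funD; [apply: emeasurable_funD|]; exact/measurable_EFinP.
  move=> x _; rewrite -!EFinD lee_fin !indicE.
  case: (x \in K); case: (x + h \in K); rewrite ?mul1r ?mul0r ?mulr0 ?mul0r ?add0r ?addr0 //.
  rewrite (_ : U (x + h) - U x = (U (x + h) - w j (x + h)) + (w j (x + h) - w j x) - (U x - w j x));
    last by ring.
  by apply: le_trans (ler_normB _ _) _; rewrite lerD2r; exact: ler_normD.
have b0 : bound j @[j --> \oo] --> (0 : R).
  rewrite /bound -[X in _ --> X](_ : 0 * one + (\sum_b `|h ord0 b| * (0 * one)) + 0 * one = 0); last first.
    by rewrite !mul0r add0r addr0 big1 // => b _; rewrite mulr0.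
  apply: cvgD; first apply: cvgD.
  - by apply: cvgM; [exact: wu|exact: cvg_cst].
  - apply: cvg_big => [|b _]; first exact: add_continuous.
    by apply: cvgM; [exact: cvg_cst|apply: cvgM; [exact: dw0|exact: cvg_cst]].
  - by apply: cvgM; [exact: wu|exact: cvg_cst].
apply/eqP; rewrite eq_le; apply/andP; split; last first.
  by apply: integral_ge0 => x _; rewrite lee_fin !mulr_ge0.
apply/lee_addgt0Pr => e e0; rewrite add0e.
move/cvgrPdist_le: b0 => /(_ _ e0) [N _ /(_ N (leqnn N))].
rewrite sub0r normrN => hN; apply: le_trans (hb N) _.
by rewrite lee_fin (le_trans (ler_norm _)).
Qed.

End constancy.

(** * Test functions and weak gradients *)

Section test_functions.
Context {R : realType} {n : nat}.
Implicit Types (D A : set 'rV[R]_n.+1) (u v psi f : 'rV[R]_n.+1 -> R)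
  (g : 'I_n.+1 -> 'rV[R]_n.+1 -> R).
Local Notation mu := (lebesgue_row n.+1).
Local Notation e_ b := (delta_mx ord0 b : 'rV[R]_n.+1).

Lemma compact_coor_bounded A : compact A ->
  exists M, forall x, A x -> forall i, `|x ord0 i| <= M.
Proof.
move=> /compact_bounded[M [_ hM]]; exists (M + 1) => x Ax.
by apply/row_normP; apply: hM => //; rewrite ltrDl.
Qed.

Lemma compact_measure_finite A : compact A -> measurable A /\ (mu A < +oo)%E.
Proof.
move=> cA; have mA : measurable A.
  by apply: closed_measurable_row; apply: compact_closed => //; exact: norm_hausdorff.
split=> //; have [M hM] := compact_coor_bounded cA.
exact: finite_measure_bounded hM.
Qed.

Lemma compact_continuous_bounded A f : compact A -> continuous f ->
  exists M, forall x, A x -> `|f x| <= M.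
Proof.
move=> cA cf.
have : compact (f @` A) by apply: continuous_compact => //; exact: continuous_subspaceT.
move=> /compact_bounded[M [_ hM]]; exists (M + 1) => x Ax.
by apply: (hM (M + 1)); [rewrite ltrDl|exists x].
Qed.

Lemma compact_support_integrable A f : compact A -> continuous f ->
  (forall x, ~ A x -> f x = 0) -> mu.-integrable setT (EFin \o f).
Proof.
move=> cA cf f0; have [mA Afin] := compact_measure_finite cA.
have [M hM] := compact_continuous_bounded cA cf.
have mf := continuous_measurable_row cf.
have /L2_integrable : L2 A f by exact: L2_bounded mf hM.
move=> /(_ mA Afin) h.
rewrite (_ : EFin \o f = (EFin \o f) \_ A).
  by apply/(integrable_restrict mu mA measurableT); rewrite setTI.
apply/funext => x; rewrite patchE; case: ifPn => //= /negP xA.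
by rewrite f0 // => Ax; apply: xA; rewrite inE.
Qed.

Lemma partial_support A f b : closed A -> (forall x, ~ A x -> f x = 0) ->
  forall x, ~ A x -> partial b f x = 0.
Proof.
move=> cA f0 x Ax.
have nA : \forall y \near x, f y = cst 0 y.
  have : nbhs x (~` A) by apply: open_nbhs_nbhs; split => //; exact: closed_openC.
  by apply: filterS => y; exact: f0.
by rewrite /partial (near_eq_derive _ nA) derive_cst.
Qed.

Lemma foldr_partial_rcons f b (s : seq 'I_n.+1) :
  foldr partial (partial b f) s = foldr partial f (rcons s b).
Proof. by rewrite -cats1 foldr_cat. Qed.

Lemma smooth_partial f b : smooth f -> smooth (partial b f).
Proof. by move=> sf s /=; rewrite foldr_partial_rcons; exact: sf. Qed.

Lemma test_function_partial D psi b : test_function D psi ->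
  test_function D (partial b psi).
Proof.
move=> [spsi [A [cA AD] psi0]]; split; first exact: smooth_partial.
exists A => //; apply: partial_support => //.
by apply: compact_closed => //; exact: norm_hausdorff.
Qed.

Lemma test_function_L2 D psi : measurable D -> (mu D < +oo)%E ->
  test_function D psi -> L2 D psi.
Proof.
move=> mD Dfin [spsi [A [cA AD] psi0]].
have [cpsi _] := smooth_C1 spsi.
have [M hM] := compact_continuous_bounded cA cpsi.
apply: (L2_bounded (M := `|M|) mD Dfin (continuous_measurable_row cpsi)) => x Dx.
have [Ax|Ax] := pselect (A x); first by rewrite (le_trans (hM x Ax)) // ler_norm.
by rewrite psi0 // normr0.
Qed.

Lemma weak_grad_lin D c u v g h : measurable D -> (mu D < +oo)%E ->
  L2 D u -> L2 D v -> weak_grad D u g -> weak_grad D v h ->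
  weak_grad D (fun x => c * u x + v x) (fun b x => c * g b x + h b x).
Proof.
move=> mD Dfin uL2 vL2 ug vh b; have [gL2 ugb] := ug b; have [hL2 vhb] := vh b.
split; first exact: L2_lin.
move=> psi tpsi.
have psiL2 := test_function_L2 mD Dfin tpsi.
have dpsiL2 := test_function_L2 mD Dfin (test_function_partial b tpsi).
have lin (f1 f2 k : 'rV[R]_n.+1 -> R) : L2 D f1 -> L2 D f2 -> L2 D k ->
    \int[mu]_(x in D) ((c * f1 x + f2 x) * k x) =
    c * \int[mu]_(x in D) (f1 x * k x) + \int[mu]_(x in D) (f2 x * k x).
  move=> h1 h2 hk.
  rewrite -RintegralZl //; last exact: L2_mul_integrable.
  rewrite -RintegralD //; last exact: L2_mul_integrable.
    by apply: eq_Rintegral => x _; rewrite mulrDl mulrA.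
  have := L2_mul_integrable mD (L2_lin (c - 1) h1 h1) hk.
  by apply: eq_integrable => // x _ /=; congr EFin; ring.
by rewrite !lin // ugb // vhb // opprD mulrN.
Qed.

(** Averaging over the segment from x to x + e_b, the integral of the partial derivative is
the one of f (x + e_b) - f x, which is zero by invariance under translation. *)
Lemma integral_partial0 f b : continuous f -> (forall x, derivable f x (e_ b)) ->
  continuous (partial b f) -> mu.-integrable setT (EFin \o f) ->
  mu.-integrable setT (EFin \o partial b f) ->
  (\int[mu]_x (partial b f x)%:E = 0)%E.
Proof.
move=> cf df cdf fi dfi.
pose I01 := (`[0%R, 1%R]%classic : set (measurableTypeR R)).
pose leb := (@lebesgue_measure R).
have mI : measurable I01 by exact: measurable_itv.
have l01 : leb I01 = 1%E.
  by rewrite /leb /= lebesgue_measure_itv /= lte_fin ltr01 oppr0 adde0.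
have mf := continuous_measurable_row cf.
have mdf := continuous_measurable_row cdf.
pose F (z : measurableTypeR R * 'rV[R]_n.+1) : \bar R :=
  (\1_I01 z.1 * partial b f (z.2 + (z.1 : R) *: e_ b))%:E.
have mF : measurable_fun [set: measurableTypeR R * 'rV[R]_n.+1] F.
  apply/measurable_EFinP; apply: measurable_funM.
    by apply: (measurableT_comp (measurable_indic mI)).
  exact: (measurableT_comp mdf (measurable_segment _)).
have iF : (@lebesgue_measure R \x mu)%E.-integrable setT F.
  apply/(integrable21ltyP _ _ mF).
  have m1 : measurable_fun [set: 'rV[R]_n.+1] (fun x => `|partial b f x|).
    exact: measurableT_comp.
  rewrite (_ : (\int[mu]_y _)%E = (\int[mu]_x (`|partial b f x|)%:E)%E).
    by move/integrableP : dfi => [].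
  rewrite -(ge0_integral_segment (e_ b) m1 (fun x => normr_ge0 _)).
  apply: eq_integral => x _; rewrite [RHS]integral_mkcond; apply: eq_integral => s _.
  by rewrite /F /= patchE indicE; case: ifP => _; rewrite ?mul1r // mul0r normr0.
have := @Fubini _ _ _ _ _ (@lebesgue_measure R) mu F iF.
have -> : (\int[lebesgue_measure]_s \int[mu]_x F (s, x) = \int[mu]_x (partial b f x)%:E)%E.
  transitivity (\int[leb]_(s in I01) \int[mu]_x (partial b f x)%:E)%E.
    rewrite [RHS]integral_mkcond; apply: eq_integral => s _; rewrite /F /= patchE indicE.
    case: ifP => _.
      under eq_integral do rewrite mul1r.
      apply: (integral_row_translate (s *: e_ b) (f := EFin \o partial b f)).
      exact/measurable_EFinP.
    by under eq_integral do rewrite mul0r; rewrite integral0.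
  have /integrable_fin_num dfin := dfi.
  rewrite -(fineK (dfin measurableT)) integral_cst //.
  by rewrite [X in (_ * X)%E]l01 mule1.
move=> ->.
transitivity (\int[mu]_x ((f (x + e_ b))%:E - (f x)%:E))%E.
  apply: eq_integral => x _; rewrite -EFinB -path_FTC //.
  rewrite [RHS]integral_mkcond; apply: eq_integral => s _.
  by rewrite /F /= patchE indicE; case: ifP => _; rewrite ?mul1r // mul0r.
have fti : mu.-integrable setT (fun x => (f (x + e_ b))%:E).
  apply/integrableP; split.
    by apply/measurable_EFinP; exact: (measurableT_comp mf (measurable_addr _)).
  move/integrableP : fi => [_].
  rewrite -(ge0_integral_row_translate (e_ b)) //.
  by apply: measurableT_comp => //; exact/measurable_EFinP.
rewrite integralB //.
rewrite (integral_row_translate (e_ b) (f := EFin \o f)); last exact/measurable_EFinP.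
by rewrite subee //; exact: integrable_fin_num.
Qed.

End test_functions.

(** * Affine functions *)

Section affine_functions.
Context {R : realType} {n : nat}.
Implicit Types (D : set 'rV[R]_n.+1) (a : 'I_n.+1 -> R) (c : R).
Local Notation mu := (lebesgue_row n.+1).
Local Notation e_ b := (delta_mx ord0 b : 'rV[R]_n.+1).

Definition affine c a : 'rV[R]_n.+1 -> R := fun x => c + \sum_b a b * x ord0 b.

Lemma affine_is_derive c a x v : is_derive x v (affine c a) (\sum_b a b * v ord0 b).
Proof.
suff h : (fun h : R => h^-1 *: (affine c a (h *: v + x) - affine c a x)) @ 0^' -->
    \sum_b a b * v ord0 b.
  by split; [exact: cvgP h|exact: cvg_lim h].
apply: cvg_near_cst; near=> h.
have h0 : h != 0 by near: h; exact: nbhs_dnbhs_neq.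
rewrite /affine opprD addrACA subrr add0r -sumrB.
rewrite (_ : \sum_(i < n.+1) _ = h * \sum_b a b * v ord0 b) ?scalerA ?mulVf ?scale1r //.
by rewrite mulr_sumr; apply: eq_bigr => b _; rewrite !mxE; ring.
Unshelve. all: by end_near. Qed.

Lemma partial_affine c a b : partial b (affine c a) = cst (a b).
Proof.
apply/funext => x; rewrite /partial; case: (affine_is_derive c a x (e_ b)) => _ ->.
rewrite (bigD1 b) //= mxE !eqxx mulr1 big1 ?addr0 // => i ib.
by rewrite mxE (negbTE ib) andbF mulr0.
Qed.

Lemma cst_affine c : cst c = affine c (fun=> 0).
Proof. by apply/funext => x; rewrite /affine big1 ?addr0 // => b _; rewrite mul0r. Qed.

Lemma affine_continuous c a : continuous (affine c a).
Proof.
have cs : continuous (fun x : 'rV[R]_n.+1 => \sum_b a b * x ord0 b).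
  apply: continuous_big => [|b _ x]; first exact: add_continuous.
  exact: (cvgM (cvg_cst (a b)) (@coord_continuous R 1 n.+1 ord0 b x)).
by move=> x; exact: (cvgD (cvg_cst c) (cs x)).
Qed.

Lemma smooth_affine c a : smooth (affine c a).
Proof.
move=> s; have [c' [a' ->]] : exists c' a', foldr partial (affine c a) s = affine c' a'.
  elim: s => [|b s [c' [a' E]]] /=; first by exists c, a.
  by rewrite E partial_affine cst_affine; eexists; eexists.
split; first exact: affine_continuous.
by move=> x b; case: (affine_is_derive c' a' x (e_ b)).
Qed.

Lemma integral_support D A f : A `<=` D -> (forall x, ~ A x -> f x = 0) ->
  \int[mu]_(x in D) f x = \int[mu]_x f x.
Proof.
move=> AD f0; rewrite Rintegral_mkcond; apply: eq_Rintegral => x _.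
rewrite patchE; case: ifPn => // /negP xD; rewrite f0 // => /AD Dx.
by apply: xD; rewrite inE.
Qed.

(** The product of an affine function and a test function has compact support, so the
integral of its partial derivatives vanishes. *)
Lemma weak_grad_affine D c a : measurable D -> (mu D < +oo)%E ->
  weak_grad D (affine c a) (fun b _ => a b).
Proof.
move=> mD Dfin b; split; first exact: L2_cst.
move=> psi tpsi; have [spsi [A [cA AD] psi0]] := tpsi.
have [cpsi dpsi] := smooth_C1 spsi; have [ddpsi cdpsi] := dpsi b.
have cfi := affine_continuous (c := c) (a := a).
have clA : closed A by apply: compact_closed => //; exact: norm_hausdorff.
have dpsi0 := partial_support b clA psi0.
pose F x := affine c a x * psi x.
have dF x : is_derive x (e_ b) F (affine c a x * partial b psi x + psi x * a b).
  have h1 := affine_is_derive c a x (e_ b).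
  have h2 : is_derive x (e_ b) psi (partial b psi x) by exact/derivableP.
  have h3 := is_deriveM h1 h2; apply: (is_derive_eq h3).
  rewrite (_ : \sum_(i < _) _ = a b) //.
  by case: h1 => _ <-; rewrite -[LHS]/(partial b (affine c a) x) partial_affine.
have pF : partial b F = (fun x => affine c a x * partial b psi x + psi x * a b).
  by apply/funext => x; case: (dF x).
have cF : continuous F by move=> x; apply: continuousM; [exact: cfi|exact: cpsi].
have c1 : continuous (fun x => affine c a x * partial b psi x).
  by move=> x; apply: continuousM; [exact: cfi|exact: cdpsi].
have c2 : continuous (fun x => a b * psi x).
  by move=> x; apply: (@continuousM _ _ (fun=> a b)); [exact: cst_continuous|exact: cpsi].
have s1 x : ~ A x -> affine c a x * partial b psi x = 0.
  by move=> Ax; rewrite dpsi0 // mulr0.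
have s2 x : ~ A x -> a b * psi x = 0 by move=> Ax; rewrite psi0 // mulr0.
have i1 := compact_support_integrable cA c1 s1.
have i2 := compact_support_integrable cA c2 s2.
have pF' : partial b F = (fun x => affine c a x * partial b psi x + a b * psi x).
  by rewrite pF; apply/funext => x; rewrite [psi x * _]mulrC.
have cpF : continuous (partial b F).
  by rewrite pF' => x; exact: (cvgD (c1 x) (c2 x)).
have sF x : ~ A x -> F x = 0 by move=> Ax; rewrite /F psi0 // mulr0.
have spF x : ~ A x -> partial b F x = 0 by move=> Ax; rewrite pF' s1 // s2 // addr0.
rewrite (integral_support AD s1) (integral_support AD s2).
apply/eqP; rewrite -addr_eq0 -RintegralD //; apply/eqP.
have dF' x : derivable F x (e_ b) by case: (dF x).
have := integral_partial0 cF dF' cpF (compact_support_integrable cA cF sF)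
   (compact_support_integrable cA cpF spF).
by rewrite pF' /Rintegral => ->.
Qed.

End affine_functions.

(** * Traces and degrees of freedom *)

Section traces.
Context {R : realType} {n : nat}.
Implicit Types (D : set 'rV[R]_n.+1) (p : 'I_n.+2 -> 'rV[R]_n.+1)
  (u v h : 'rV[R]_n.+1 -> R) (g : 'I_n.+1 -> 'rV[R]_n.+1 -> R).
Local Notation mu := (lebesgue_row n.+1).

Lemma simplex_bounded p : exists M, forall x, simplex p x -> forall i, `|x ord0 i| <= M.
Proof.
exists (\sum_j `|p j|) => x [l [l0 _ l1 ->]] i.
rewrite summxE; apply: le_trans (ler_norm_sum _ _ _) _; apply: ler_sum => j _.
rewrite mxE normrM ger0_norm //; apply: (@le_trans _ _ (1 * `|p j ord0 i|)).
  by rewrite ler_wpM2r // -l1 (bigD1 j) //= lerDl sumr_ge0.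
by rewrite mul1r; exact: ((row_normP (p j) _).1 (lexx _)).
Qed.

Lemma measurable_interior D : measurable D°.
Proof. by apply: open_measurable_row; exact: open_interior. Qed.

Lemma simplex_interior_finite p : (mu (simplex p)° < +oo)%E.
Proof.
have [M hM] := simplex_bounded p.
apply: (finite_measure_bounded (M := M) (measurable_interior _)) => x /interior_subset.
exact: hM.
Qed.

Lemma bounded_continuous_L2 k (E : set 'rV[R]_k) (f : 'rV[R]_k -> R) (M : R) : measurable E ->
  (forall x, E x -> forall i, `|x ord0 i| <= M) -> continuous f -> L2 E f.
Proof.
move=> mE hM cf.
have cC : compact [set x : 'rV[R]_k | forall i, `[- M, M]%classic (x ord0 i)].
  by apply: (@rV_compact _ _ (fun=> `[- M, M]%classic)) => _; exact: segment_compact.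
have : compact (f @` [set x : 'rV[R]_k | forall i, `[- M, M]%classic (x ord0 i)]).
  by apply: continuous_compact => //; exact: continuous_subspaceT.
move=> /compact_bounded[B [_ hB]].
apply: (L2_bounded (M := B + 1) mE (finite_measure_bounded mE hM) (continuous_measurable_row cf)).
move=> x Ex; apply: (hB (B + 1)); first by rewrite ltrDl.
by exists x => // i; rewrite /= in_itv /= -ler_norml; exact: hM.
Qed.

Lemma smooth_L2 p f : smooth f -> L2 (simplex p)° f.
Proof.
move=> sf; have [M hM] := simplex_bounded p.
apply: (bounded_continuous_L2 (M := M) (measurable_interior _)); last exact: (smooth_C1 sf).1.
by move=> x /interior_subset; exact: hM.
Qed.

Lemma L2norm_H1norm D u g : (L2norm D u <= H1norm D u g) /\
  forall b, L2norm D (g b) <= H1norm D u g.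
Proof.
have s0 : 0 <= \sum_b L2norm D (g b) ^+ 2 by apply: sumr_ge0 => b _; exact: sqr_ge0.
split=> [|b]; rewrite /H1norm -[leLHS]ger0_norm ?L2norm_ge0 // -sqrtr_sqr ler_wsqrtr //.
  by rewrite lerDl.
rewrite (bigD1 b) //= addrCA lerDl addr_ge0 ?sqr_ge0 //.
by apply: sumr_ge0 => i _; exact: sqr_ge0.
Qed.

Lemma H1norm_le D u g : H1norm D u g <= L2norm D u + \sum_b L2norm D (g b).
Proof.
have s0 : 0 <= \sum_b L2norm D (g b) by apply: sumr_ge0 => b _; exact: L2norm_ge0.
have t0 := L2norm_ge0 D u.
rewrite -[leRHS]ger0_norm ?addr_ge0 // -sqrtr_sqr ler_wsqrtr // sqrrD.
apply: (@le_trans _ _ (L2norm D u ^+ 2 + (\sum_b L2norm D (g b)) ^+ 2)); last first.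
  by rewrite lerD2r lerDl mulrn_wge0 // mulr_ge0.
rewrite lerD2l expr2 mulr_suml; apply: ler_sum => b _.
rewrite expr2 ler_wpM2l ?L2norm_ge0 // (bigD1 b) //= lerDl.
by apply: sumr_ge0 => i _; exact: L2norm_ge0.
Qed.

Lemma cvg_dominated0 (f g : nat -> R) : (forall j, 0 <= f j <= g j) ->
  g j @[j --> \oo] --> (0 : R) -> f j @[j --> \oo] --> (0 : R).
Proof.
move=> fg g0; apply: (squeeze_cvgr _ (cvg_cst 0) g0).
by apply: nearW.
Qed.

Lemma H1cvgP D (w : nat -> 'rV[R]_n.+1 -> R) u g : H1cvg D w u g <->
  L2norm D (fun x => w j x - u x) @[j --> \oo] --> (0 : R) /\
  forall b, L2norm D (fun x => partial b (w j) x - g b x) @[j --> \oo] --> (0 : R).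
Proof.
split=> [h|[h1 h2]].
  split=> [|b]; apply: cvg_dominated0 h => j; rewrite L2norm_ge0 /=.
    exact: (L2norm_H1norm _ _ _).1.
  exact: ((L2norm_H1norm D _ (fun b x => partial b (w j) x - g b x)).2 b).
have hs : \sum_b L2norm D (fun x => partial b (w j) x - g b x) @[j --> \oo] --> (\sum_(b < n.+1) 0 : R).
  by apply: cvg_big => [|b _]; [exact: add_continuous|exact: h2].
have h3 : L2norm D (fun x => w j x - u x) + \sum_b L2norm D (fun x => partial b (w j) x - g b x)
    @[j --> \oo] --> (0 + \sum_(b < n.+1) 0 : R) by exact: cvgD.
rewrite big1 // addr0 in h3.
rewrite /H1cvg; apply: (cvg_dominated0 _ h3) => j.
by rewrite H1norm_le andbT sqrtr_ge0.
Qed.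

(** Used for the values, the partial derivatives and the traces of approximating
sequences. *)
Lemma L2norm_lin_cvg0 k (D : set 'rV[R]_k) c (f g : nat -> 'rV[R]_k -> R) :
  (forall j, L2 D (f j)) -> (forall j, L2 D (g j)) ->
  L2norm D (f j) @[j --> \oo] --> (0 : R) -> L2norm D (g j) @[j --> \oo] --> (0 : R) ->
  L2norm D (fun x => c * f j x + g j x) @[j --> \oo] --> (0 : R).
Proof.
move=> hf hg f0 g0.
have : `|c| * L2norm D (f j) + L2norm D (g j) @[j --> \oo] --> (`|c| * 0 + 0 : R).
  by apply: cvgD => //; apply: cvgM => //; exact: cvg_cst.
rewrite mulr0 addr0; apply: cvg_dominated0 => j; rewrite L2norm_ge0 /= -L2normZ //.
apply: L2normD => //; have := L2_lin (c - 1) (hf j) (hf j).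
by under eq_fun do rewrite mulrBl mul1r subrK.
Qed.

Lemma partial_lin b c (f g : 'rV[R]_n.+1 -> R) :
  (forall x, derivable f x (delta_mx ord0 b)) -> (forall x, derivable g x (delta_mx ord0 b)) ->
  (forall x, derivable (fun x => c * f x + g x) x (delta_mx ord0 b)) /\
  partial b (fun x => c * f x + g x) = (fun x => c * partial b f x + partial b g x).
Proof.
move=> df dg.
have E : (fun x => c * f x + g x) = (c \*: f) + g by apply/funext.
rewrite E; split=> [x|]; first by apply: derivableD => //; exact: derivableZ.
apply/funext => x; rewrite /partial deriveD //; last exact: derivableZ.
by rewrite deriveZ.
Qed.

Lemma smooth_lin c (f g : 'rV[R]_n.+1 -> R) : smooth f -> smooth g ->
  smooth (fun x => c * f x + g x).
Proof.
move=> sf sg s.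
have -> : foldr partial (fun x => c * f x + g x) s =
    (fun x => c * foldr partial f s x + foldr partial g s x).
  elim: s => //= b s ->.
  by rewrite (partial_lin c (fun x => (sf s).2 x b) (fun x => (sg s).2 x b)).2.
have [cf df] := sf s; have [cg dg] := sg s; split => [x|x b].
  apply: (@continuousD _ _ _ (fun x => c * foldr partial f s x)); last exact: cg.
  by apply: (@continuousM _ _ (fun=> c)); [exact: cst_continuous|exact: cf].
exact: (partial_lin c (fun x => df x b) (fun x => dg x b)).1.
Qed.

Lemma L2B k (D : set 'rV[R]_k) (u v : 'rV[R]_k -> R) : L2 D u -> L2 D v ->
  L2 D (fun x => u x - v x).
Proof.
move=> hu hv; have := L2_lin (-1) hv hu.
by under eq_fun do rewrite mulN1r addrC.
Qed.

Lemma ref_simplex_closed : closed (@ref_simplex R n).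
Proof.
rewrite (_ : ref_simplex = (\bigcap_(j in [set: 'I_n]) ((fun t : 'rV[R]_n => t ord0 j) @^-1` [set r | 0 <= r])) `&`
  ((fun t : 'rV[R]_n => \sum_j t ord0 j) @^-1` [set r | r <= 1])); last first.
  apply/seteqP; split=> [t [h1 h2]|t [h1 h2]]; split=> // j *; exact: h1.
apply: closedI.
  apply: closed_bigI => j _; apply: preimage_closed; last exact: closed_ge.
  by move=> t _; exact: coord_continuous.
apply: preimage_closed; last exact: closed_le.
have cs : continuous (fun t : 'rV[R]_n => \sum_j t ord0 j).
  by apply: continuous_big => [|j _]; [exact: add_continuous|exact: coord_continuous].
by move=> t _; exact: cs.
Qed.

Lemma ref_simplex_measurable : measurable (@ref_simplex R n).
Proof. by apply: closed_measurable_row; exact: ref_simplex_closed. Qed.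

Lemma ref_simplex_bounded (t : 'rV[R]_n) : ref_simplex t -> forall i, `|t ord0 i| <= 1.
Proof.
move=> [t0 t1] i; rewrite ger0_norm //; apply: le_trans t1.
by rewrite (bigD1 i) //= lerDl sumr_ge0.
Qed.

Lemma ref_simplex_finite : (lebesgue_row n (@ref_simplex R n) < +oo)%E.
Proof. exact: finite_measure_bounded ref_simplex_measurable ref_simplex_bounded. Qed.

(** In dimension 0 it is the single point, of mass 1; in general it contains a cube. *)
Lemma ref_simplex_gt0 : (0 < lebesgue_row n (@ref_simplex R n))%E.
Proof.
pose r : R := n.+1%:R^-1.
have r0 : 0 < r by rewrite invr_gt0 ltr0n.
apply: (@lt_le_trans _ _ (lebesgue_row n [set x : 'rV[R]_n | forall i, 0 <= x ord0 i <= r])).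
  by rewrite lebesgue_row_cube ?ltW // lte_fin subr0 exprn_gt0.
apply: le_measure; rewrite ?inE; [|exact: ref_simplex_measurable|].
  apply: closed_measurable_row; rewrite (_ : mkset _ =
     \bigcap_(i in [set: 'I_n]) ((fun x : 'rV[R]_n => x ord0 i) @^-1` `[0, r]%classic)); last first.
    by apply/seteqP; split => x /= h i *; have := h i; rewrite /= in_itv /=; try exact.
  apply: closed_bigI => i _; apply: preimage_closed; last exact: interval_closed.
  by move=> x _; exact: coord_continuous.
move=> x h; split=> [j|]; first by case/andP: (h j).
apply: (@le_trans _ _ (\sum_(j < n) r)); first by apply: ler_sum => j _; case/andP: (h j).
by rewrite sumr_const card_ord -mulr_natl ler_pdivrMr ?ltr0n // mul1r ler_nat.
Qed.

Lemma facet_param_continuous p i : continuous (facet_param p i).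
Proof.
have cs : continuous (fun t : 'rV[R]_n => \sum_j t ord0 j *: (p (lift i (lift ord0 j)) - p (lift i ord0))).
  apply: continuous_big => [|j _ t]; first exact: add_continuous.
  apply: (@continuous_comp _ _ _ (fun t : 'rV[R]_n => t ord0 j)
    (fun s : R => s *: (p (lift i (lift ord0 j)) - p (lift i ord0)))).
    exact: coord_continuous.
  by apply: cvgZr_tmp; exact: cvg_id.
by move=> t; exact: (cvgD (cvg_cst _) (cs t)).
Qed.

Lemma facet_param_L2 p i (f : 'rV[R]_n.+1 -> R) : continuous f ->
  L2 ref_simplex (f \o facet_param p i).
Proof.
move=> cf; apply: (bounded_continuous_L2 (M := 1) ref_simplex_measurable ref_simplex_bounded).
move=> t; apply: continuous_comp; [exact: facet_param_continuous|exact: cf].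
Qed.

Lemma is_trace_lin p i c u v h h' : is_trace p i u h -> is_trace p i v h' ->
  is_trace p i (fun x => c * u x + v x) (fun x => c * h x + h' x).
Proof.
move=> [hL2 [g [[uL2 ug] [w [sw wu wh]]]]] [h'L2 [g' [[vL2 vg'] [w' [sw' wv wh']]]]].
have mK := measurable_interior (simplex p); have Kfin := simplex_interior_finite p.
move/H1cvgP: wu => [wu dwu]; move/H1cvgP: wv => [wv dwv].
split; first exact: (L2_lin c hL2 h'L2).
exists (fun b x => c * g b x + g' b x); split.
  by split; [exact: L2_lin|exact: weak_grad_lin].
exists (fun j x => c * w j x + w' j x); split.
- by move=> j; exact: smooth_lin.
- apply/H1cvgP; split=> [|b].
    under eq_fun => j do [under eq_L2norm => x _ do rewrite opprD addrACA -mulrBr].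
    by apply: L2norm_lin_cvg0 => // j; apply: L2B => //; exact: smooth_L2.
  have dw j := (partial_lin c ((smooth_C1 (sw j)).2 b).1 ((smooth_C1 (sw' j)).2 b).1).2.
  under eq_fun => j do [rewrite dw; under eq_L2norm => x _ do rewrite opprD addrACA -mulrBr].
  apply: L2norm_lin_cvg0 => // j; apply: L2B.
  + by apply: smooth_L2; exact: smooth_partial.
  + by case: (ug b).
  + by apply: smooth_L2; exact: smooth_partial.
  + by case: (vg' b).
- under eq_fun => j do [under eq_L2norm => x _ do rewrite opprD addrACA -mulrBr].
  apply: L2norm_lin_cvg0 => // j; apply: L2B => //.
    by apply: facet_param_L2; exact: (smooth_C1 (sw j)).1.
  by apply: facet_param_L2; exact: (smooth_C1 (sw' j)).1.
Qed.

Lemma facet_int1_gt0 p i : 0 < facet_int p i (cst 1).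
Proof.
rewrite /facet_int (_ : Rintegral _ _ _ = fine (lebesgue_row n (@ref_simplex R n))); last first.
  by rewrite [LHS](Rintegral_cst _ ref_simplex_measurable) mul1r.
by rewrite fine_gt0 // ref_simplex_gt0 ref_simplex_finite.
Qed.

Lemma facet_int_lin p i c u v : L2 ref_simplex (u \o facet_param p i) ->
  L2 ref_simplex (v \o facet_param p i) ->
  facet_int p i (fun x => c * u x + v x) = c * facet_int p i u + facet_int p i v.
Proof.
move=> uL2 vL2; have mS := ref_simplex_measurable; have Sfin := ref_simplex_finite.
have iu := L2_integrable mS Sfin uL2.
rewrite /facet_int -RintegralZl // RintegralD //; last exact: L2_integrable.
apply: L2_integrable => //; have := L2_lin (c - 1) uL2 uL2.
by under eq_fun do rewrite mulrBl mul1r subrK.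
Qed.

Lemma facet_mean_lin p i c u v : L2 ref_simplex (u \o facet_param p i) ->
  L2 ref_simplex (v \o facet_param p i) ->
  facet_mean p i (fun x => c * u x + v x) = c * facet_mean p i u + facet_mean p i v.
Proof. by move=> hu hv; rewrite /facet_mean facet_int_lin // mulrDl mulrA. Qed.

Lemma is_dof_lin k p i c u v y z : is_dof k p u i y -> is_dof k p v i z ->
  is_dof k p (fun x => c * u x + v x) i (c * y + z).
Proof.
case: k => /= [hu hv j ji|[h hu ->] [h' hv ->]].
  have [h hu1 hu2] := hu j ji; have [h' hv1 hv2] := hv j ji.
  exists (fun x => c * h x + h' x); first exact: is_trace_lin.
  by apply: cvgD => //; apply: cvgM => //; exact: cvg_cst.
exists (fun x => c * h x + h' x); first exact: is_trace_lin.
by rewrite facet_mean_lin //; [case: hu|case: hv].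
Qed.

(** An affine function is smooth, so it is its own trace and a constant approximating
sequence will do. *)
Lemma is_dof_P1 k p i v : P1 v -> is_dof k p v i (dof_P1 k p v i).
Proof.
move=> [c [a ->]]; rewrite -/(affine c a).
have tr j : is_trace p j (affine c a) (affine c a).
  split; first by apply: facet_param_L2; exact: affine_continuous.
  exists (fun b _ => a b); split.
    split; first by apply: smooth_L2; exact: smooth_affine.
    exact: weak_grad_affine (measurable_interior _) (simplex_interior_finite p).
  exists (fun=> affine c a); split=> [j'||]; first exact: smooth_affine.
    apply/H1cvgP; split=> [|b].
      under eq_fun => j' do [under eq_L2norm => x _ do rewrite subrr]; rewrite L2norm0.
      exact: cvg_cst.
    under eq_fun => j' do [under eq_L2norm => x _ do rewrite partial_affine subrr]; rewrite L2norm0.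
    exact: cvg_cst.
  under eq_fun => j' do [under eq_L2norm => x _ do rewrite subrr]; rewrite L2norm0.
  exact: cvg_cst.
case: k => /= [j ji|]; last by exists (affine c a).
exists (affine c a) => //; apply: cvg_within_filter; exact: affine_continuous.
Qed.

(** Weak gradients and the H^1 norm are insensitive to null sets, so the same smooth
functions approximate u and v. *)
Lemma is_trace_ae p i u v h : L2 (simplex p)° u ->
  u = v %[ae mu in (simplex p)°] -> is_trace p i v h -> is_trace p i u h.
Proof.
move=> uL2 uv [hL2 [g [[vL2 vg] [w [sw wv wh]]]]].
have mK := measurable_interior (simplex p); have Kfin := simplex_interior_finite p.
split=> //; exists g; split; first split=> // b.
  have [gL2 vgb] := vg b; split=> // psi tpsi; rewrite -vgb //.
  have dpsiL2 := test_function_L2 mK Kfin (test_function_partial b tpsi).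
  rewrite /Rintegral; congr fine; apply: ae_eq_integral => //.
  - exact: measurable_int (L2_mul_integrable mK uL2 dpsiL2).
  - exact: measurable_int (L2_mul_integrable mK vL2 dpsiL2).
  by apply: filterS uv => x h' Kx; rewrite /= h'.
exists w; split=> //; apply/H1cvgP; move/H1cvgP : wv => [wv dwv]; split=> //.
have vu0 : L2norm (simplex p)° (fun x => v x - u x) = 0.
  apply: (ae_L2norm0 mK); first exact: L2B.
  by apply: filterS uv => x h' Kx; rewrite h' // subrr.
apply: cvg_dominated0 wv => j; rewrite L2norm_ge0 /=.
have wL2 : L2 (simplex p)° (fun x => w j x - v x) by apply: L2B => //; exact: smooth_L2.
have := L2normD wL2 (L2B vL2 uL2); rewrite vu0 addr0; apply: le_trans.
by rewrite le_eqVlt (@eq_L2norm _ _ _ _ (fun x => w j x - v x + (v x - u x))) ?eqxx // => x _; rewrite addrA subrK.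
Qed.

Lemma dof_P1_cst k p i c : dof_P1 k p (cst c) i = c.
Proof.
case: k => //=; rewrite /facet_mean.
have E : facet_int p i (cst c) = c * facet_int p i (cst 1).
  have L1 c' : L2 ref_simplex (cst c' \o facet_param p i).
    by apply: facet_param_L2; exact: cst_continuous.
  have := facet_int_lin c (L1 1) (L1 0).
  have -> : facet_int p i (cst 0) = 0.
    by rewrite /facet_int (Rintegral_cst _ ref_simplex_measurable) mul0r.
  rewrite addr0 => <-; congr facet_int; apply/funext => x /=; by rewrite mulr1 addr0.
by rewrite E mulfK // gt_eqF // facet_int1_gt0.
Qed.

Lemma is_dof_ae_cst k p i u c : L2 (simplex p)° u ->
  u = (fun=> c) %[ae mu in (simplex p)°] -> is_dof k p u i c.
Proof.
move=> uL2 uc.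
have : is_dof k p (cst c) i (dof_P1 k p (cst c) i).
  by apply: is_dof_P1; rewrite cst_affine; exists c, (fun=> 0).
rewrite dof_P1_cst; case: k => /= [h j ji|[h hc ->]].
  by have [h' h1 h2] := h j ji; exists h' => //; exact: is_trace_ae h1.
by exists h => //; exact: is_trace_ae hc.
Qed.

Lemma simplex_convex p : convex_set (simplex p).
Proof.
move=> x v [l [l0 _ l1 xE]] [l' [l'0 _ l'1 x'E]] s /andP[s0 s1].
have s1' : 0 <= 1 - s by rewrite subr_ge0.
exists (fun i => (1 - s) * l i + s * l' i); split=> //.
- by move=> i; rewrite addr_ge0 // mulr_ge0.
- by move=> i /(_ I).
- by rewrite big_split /= -!mulr_sumr l1 l'1; ring.
under eq_bigr do rewrite scalerDl -!scalerA.
by rewrite big_split /= -!scaler_sumr -x'E -xE scalerDr addrA -scalerDl subrK scale1r.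
Qed.

Lemma interior_convex D : convex_set D -> convex_set D°.
Proof.
move=> cD x v /nbhs_ballP[e /= e0 he] /nbhs_ballP[e' /= e'0 he'] s s01.
apply/nbhs_ballP; exists (Num.min e e') => /= [|y]; first by rewrite lt_min e0.
move=> /row_ballP[_ hy].
pose d := y - (x + s *: v).
have dE i : `|d ord0 i| < Num.min e e' by have := hy i; rewrite distrC /d !mxE.
have -> : y = (x + d) + s *: v by apply/rowP => i; rewrite !mxE; ring.
apply: cD => //.
  apply: he; apply/row_ballP; split=> // i; rewrite mxE opprD addrA subrr sub0r normrN.
  by apply: lt_le_trans (dE i) _; rewrite ge_min lexx.
apply: he'; apply/row_ballP; split=> // i; rewrite (_ : _ - _ = - d ord0 i) ?normrN; last by rewrite !mxE; ring.
by apply: lt_le_trans (dE i) _; rewrite ge_min lexx orbT.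
Qed.

(** The trace provides smooth functions converging to u in H^1(K), the gradients of which
tend to 0. *)
Lemma is_trace_grad0_cst p i u h : is_trace p i u h ->
  (forall g, weak_grad (simplex p)° u g -> forall b, L2norm (simplex p)° (g b) = 0) ->
  exists c, u = (fun=> c) %[ae mu in (simplex p)°].
Proof.
move=> [_ [g [[uL2 ug] [w [sw wu _]]]]] /(_ g ug) g0.
move/H1cvgP: wu => [wu dwu].
have wL2 j : L2 (simplex p)° (w j) by exact: smooth_L2.
have dwL2 j b : L2 (simplex p)° (partial b (w j)) by apply: smooth_L2; exact: smooth_partial.
suff dw0 b : L2norm (simplex p)° (partial b (w j)) @[j --> \oo] --> (0 : R).
  exact: (gradient_limit0_cst (measurable_interior _) (simplex_interior_finite p)
    (interior_convex (@simplex_convex p)) uL2 (fun j => smooth_C1 (sw j)) wL2 dwL2 wu dw0).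
apply: cvg_dominated0 (dwu b) => j; rewrite L2norm_ge0 /=.
have [gL2 _] := ug b.
have := L2normD (L2B (dwL2 j b) gL2) gL2; rewrite g0 addr0; apply: le_trans.
by rewrite le_eqVlt (@eq_L2norm _ _ _ _ (fun x => partial b (w j) x - g b x + g b x)) ?eqxx // => x _; rewrite subrK.
Qed.

End traces.

(** * Barycentric coordinates and faces *)

Section barycentric.
Context {R : realType} {n : nat}.
Implicit Types (p q : 'I_n.+2 -> 'rV[R]_n.+1) (x v : 'rV[R]_n.+1).

(** If r is the row of barycentric coordinates of x, then r times this matrix is the row
(1, x). *)
Definition vertex_mx p : 'M[R]_(n.+2, 1 + n.+1) :=
  row_mx (const_mx 1 : 'cV[R]_n.+2) (\matrix_(i, b) p i ord0 b).

Definition bary_mx p : 'M[R]_(1 + n.+1, n.+2) :=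
  invmx (vertex_mx p : 'M[R]_n.+2).

(** The linear part of the affine map [bary]. *)
Definition dbary p v : 'rV[R]_n.+2 := v *m dsubmx (bary_mx p).

Definition bary p x : 'rV[R]_n.+2 := usubmx (bary_mx p) + dbary p x.

Lemma dbaryD p u v : dbary p (u + v) = dbary p u + dbary p v.
Proof. exact: mulmxDl. Qed.

Lemma dbaryZ p c v : dbary p (c *: v) = c *: dbary p v.
Proof. by rewrite /dbary -scalemxAl. Qed.

Lemma baryD p x v : bary p (x + v) = bary p x + dbary p v.
Proof. by rewrite /bary dbaryD addrA. Qed.

Lemma baryB p x y : bary p x - bary p y = dbary p (x - y).
Proof. by rewrite -[in LHS](subrK y x) addrC [x - y + y]addrC baryD addrA addNr add0r. Qed.

Lemma bary_ray p x v (t : R) i :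
  bary p (x + t *: v) ord0 i = bary p x ord0 i + t * dbary p v ord0 i.
Proof. by rewrite baryD dbaryZ; move: (bary p x) (dbary p v) => A B; rewrite !mxE. Qed.

Lemma dbary_sub p x y i : dbary p (x - y) ord0 i = bary p x ord0 i - bary p y ord0 i.
Proof. by rewrite -baryB; move: (bary p x) (bary p y) => A B; rewrite !mxE. Qed.

Lemma vertex_mx_unit p : affine_independent p ->
  (vertex_mx p : 'M[R]_n.+2) \in unitmx.
Proof.
move=> aip; rewrite -row_free_unit -kermx_eq0; apply/rowV0P => u /sub_kermxP h.
have : u *m (vertex_mx p : 'M[R]_(n.+2, 1 + n.+1)) = 0 by exact: h.
rewrite /vertex_mx mul_mx_row -[X in _ = X]row_mx0 => /eq_row_mx[h1 h2].
apply/rowP => i; rewrite mxE; apply: (aip (fun i => u ord0 i)).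
  move/rowP/(_ ord0): h1; rewrite !mxE => E; rewrite -[RHS]E.
  by apply: eq_bigr => j _; rewrite mxE mulr1.
apply/rowP => b; move/rowP/(_ b): h2; rewrite !mxE => E; rewrite -[RHS]E summxE.
by apply: eq_bigr => j _; rewrite !mxE.
Qed.

Lemma bary_vertex_mx p x : affine_independent p ->
  bary p x *m vertex_mx p = row_mx 1%:M x.
Proof.
move=> /vertex_mx_unit up.
have -> : bary p x = row_mx 1%:M x *m bary_mx p.
  by rewrite -[bary_mx p in RHS]vsubmxK mul_row_col mul1mx.
have E : bary_mx p *m vertex_mx p = 1%:M := mulVmx up.
by rewrite -mulmxA E mulmx1.
Qed.

Lemma bary_sum p x : affine_independent p -> \sum_i bary p x ord0 i = 1.
Proof.
move=> aip; have := bary_vertex_mx x aip.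
rewrite /vertex_mx mul_mx_row => /eq_row_mx[/rowP/(_ ord0) + _].
rewrite !mxE eqxx => E; rewrite -[RHS]E.
by apply: eq_bigr => i _; rewrite [const_mx _ _ _]mxE mulr1.
Qed.

Lemma bary_comb p x : affine_independent p -> x = \sum_i bary p x ord0 i *: p i.
Proof.
move=> aip; have := bary_vertex_mx x aip.
rewrite /vertex_mx mul_mx_row => /eq_row_mx[_ E].
apply/rowP => b; rewrite -[in LHS]E summxE mxE; apply: eq_bigr => i _.
by rewrite !mxE.
Qed.

Lemma bary_uniq p x (l : 'I_n.+2 -> R) : affine_independent p ->
  \sum_i l i = 1 -> x = \sum_i l i *: p i -> forall i, bary p x ord0 i = l i.
Proof.
move=> aip l1 xl i; apply/eqP; rewrite -subr_eq0; apply/eqP.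
apply: (aip (fun i => bary p x ord0 i - l i)); first by rewrite sumrB bary_sum // l1 subrr.
under eq_bigr do rewrite scalerBl.
by rewrite sumrB -bary_comb // -xl subrr.
Qed.

Lemma bary_vertex p i j : affine_independent p -> bary p (p j) ord0 i = (i == j)%:R.
Proof.
move=> aip; apply: (bary_uniq (l := fun i => (i == j)%:R)) => //.
  by rewrite (bigD1 j) //= eqxx big1 ?addr0 // => k /negbTE ->.
rewrite (bigD1 j) //= eqxx scale1r big1 ?addr0 // => k /negbTE ->.
by rewrite scale0r.
Qed.

Lemma bary_convex p q (c : 'I_n.+2 -> R) i : affine_independent p -> \sum_j c j = 1 ->
  bary p (\sum_j c j *: q j) ord0 i = \sum_j c j * bary p (q j) ord0 i.
Proof.
move=> aip c1.
apply: (bary_uniq (l := fun i => \sum_j c j * bary p (q j) ord0 i)) => //.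
  rewrite exchange_big /= -c1; apply: eq_bigr => j _.
  by rewrite -mulr_sumr bary_sum // mulr1.
under [in RHS]eq_bigr do rewrite scaler_suml.
rewrite exchange_big /=; apply: eq_bigr => j _.
rewrite [in LHS](bary_comb (q j) aip) scaler_sumr; apply: eq_bigr => k _.
by rewrite scalerA.
Qed.

Lemma faceP p (I : set 'I_n.+2) x : affine_independent p ->
  face p I x <-> (forall i, 0 <= bary p x ord0 i) /\ (forall i, ~ I i -> bary p x ord0 i = 0).
Proof.
move=> aip; split=> [[l [l0 lI l1 xE]]|[h1 h2]].
  by split=> i; rewrite (bary_uniq aip l1 xE) //; exact: lI.
by exists (fun i => bary p x ord0 i); split=> //; [exact: bary_sum|exact: bary_comb].
Qed.

Lemma simplexP p x : affine_independent p ->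
  simplex p x <-> forall i, 0 <= bary p x ord0 i.
Proof.
by move=> aip; split=> [/faceP[]//|h]; apply/faceP => //; split=> // i /(_ I).
Qed.

Lemma facetP p i x : affine_independent p ->
  facet p i x <-> (forall i, 0 <= bary p x ord0 i) /\ bary p x ord0 i = 0.
Proof.
move=> aip; split=> [/faceP[//|h1 h2]|[h1 h2]].
  by split=> //; apply: h2; rewrite /= => /(_ erefl).
by apply/faceP => //; split=> // j; rewrite /= => /contrapT ->.
Qed.

Lemma vertex_face p (I : set 'I_n.+2) i : I i -> face p I (p i).
Proof.
move=> Ii; exists (fun j => (j == i)%:R); split.
- by move=> j; rewrite ler0n.
- by move=> j; case: eqP => // ->.
- by rewrite (bigD1 i) //= eqxx big1 ?addr0 // => k /negbTE ->.
rewrite (bigD1 i) //= eqxx scale1r big1 ?addr0 // => k /negbTE ->.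
by rewrite scale0r.
Qed.

Lemma bary_continuous p i : continuous (fun x => bary p x ord0 i).
Proof.
have E : (fun x => bary p x ord0 i) =
    affine (usubmx (bary_mx p) ord0 i) (fun b => dsubmx (bary_mx p) b i).
  apply/funext => x; rewrite /affine /bary mxE [dbary _ _ _ _]mxE; congr (_ + _).
  by apply: eq_bigr => b _; rewrite mulrC.
by rewrite E; exact: affine_continuous.
Qed.

Lemma simplex_closed p : affine_independent p -> closed (simplex p).
Proof.
move=> aip; rewrite (_ : simplex p = \bigcap_(i in [set: 'I_n.+2])
  ((fun x => bary p x ord0 i) @^-1` [set r | 0 <= r])).
  apply: closed_bigI => i _; apply: preimage_closed; last exact: closed_ge.
  by move=> x _; exact: bary_continuous.
apply/seteqP; split=> [x /simplexP h i _|x h]; first exact: h.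
by apply/simplexP => // i; exact: h.
Qed.

(** The point p i is a convex combination of the q j in the face, at which the i-th
barycentric coordinate with respect to p is at most 1. As it is 1 at p i, it is 1 at
some q j, which forces q j = p i. *)
Lemma face_extreme p q (I J : set 'I_n.+2) i :
  affine_independent p -> affine_independent q ->
  face p I = face q J -> I i -> exists2 j, J j & q j = p i.
Proof.
move=> aip aiq IJ Ii.
have : face q J (p i) by rewrite -IJ; exact: vertex_face.
move=> [c [c0 cJ c1 E]].
have [j cj] : exists j, c j != 0.
  apply: contrapT => /forallNP h; move: c1; rewrite big1 => [/eqP|j _].
    by rewrite eq_sym oner_eq0.
  by apply/eqP/negP => /negP; exact: h.
have Jj : J j by apply: contrapT => /cJ c'; rewrite c' eqxx in cj.
exists j => //.
have qb j' : J j' -> (forall i, 0 <= bary p (q j') ord0 i).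
  by move=> Jj'; apply: ((faceP I (q j') aip).1 _).1; rewrite IJ; exact: vertex_face.
have le1 j' : J j' -> bary p (q j') ord0 i <= 1.
  move=> Jj'; rewrite -(bary_sum (q j') aip) (bigD1 i) //= lerDl sumr_ge0 // => k _.
  exact: qb.
have cj0 : 0 < c j by rewrite lt_def cj c0.
have b1 : bary p (q j) ord0 i = 1.
  apply/eqP; rewrite eq_le le1 //= leNgt; apply/negP => lt1.
  have := bary_vertex i i aip; rewrite E bary_convex // eqxx => E1.
  have : \sum_j c j * bary p (q j) ord0 i < \sum_j c j.
    rewrite (bigD1 j) //= [ltRHS](bigD1 j) //=; apply: ltr_leD.
      by rewrite -[ltRHS]mulr1 ltr_pM2l.
    apply: ler_sum => k _; have [Jk|Jk] := pselect (J k).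
      by rewrite -[leRHS]mulr1 ler_wpM2l // le1.
    by rewrite cJ // mul0r.
  by rewrite E1 c1 ltxx.
rewrite {1}(bary_comb (q j) aip) (bigD1 i) //= b1 scale1r big1 ?addr0 // => k ki.
have := bary_sum (q j) aip; rewrite (bigD1 i) //= b1 => /eqP.
rewrite -subr_eq0 addrAC subrr add0r psumr_eq0 => [/allP/(_ k)|k' _]; last exact: qb.
by rewrite mem_index_enum ki /= => /(_ isT)/eqP ->; rewrite scale0r.
Qed.

Lemma vertex_inj p : affine_independent p -> injective p.
Proof.
move=> aip i j E; have := bary_vertex i j aip; rewrite -E bary_vertex // eqxx.
by case: eqP => // _ /eqP; rewrite oner_eq0.
Qed.

(** Equal faces have the same vertices. *)
Lemma face_card p q (I J : set 'I_n.+2) :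
  affine_independent p -> affine_independent q -> face p I = face q J ->
  (#|[set i | `[< I i >]]%SET| <= #|[set j | `[< J j >]]%SET|)%N.
Proof.
move=> aip aiq IJ.
have hs i : exists j, I i -> J j /\ q j = p i.
  have [Ii|nIi] := pselect (I i); last by exists i.
  by have [j Jj E] := face_extreme aip aiq IJ Ii; exists j.
have [s hs'] := choice hs.
rewrite -(card_in_imset (f := s)) => [|i j /=].
  apply: subset_leq_card; apply/fintype.subsetP => j /imsetP[i]; rewrite finset.in_set => /asboolP Ii ->.
  by rewrite finset.in_set; apply/asboolP; case: (hs' i Ii).
rewrite !finset.in_set => /asboolP Ii /asboolP Ij E; apply: (vertex_inj aip).
by rewrite -(hs' i Ii).2 -(hs' j Ij).2 E.
Qed.

(** A facet has n.+1 vertices, so a face equal to it misses exactly one vertex. *)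
Lemma facet_of_face p q i (J : set 'I_n.+2) :
  affine_independent p -> affine_independent q -> facet p i = face q J ->
  exists j, facet p i = facet q j.
Proof.
move=> aip aiq IJ.
have c1 : #|[set k | `[< (~` [set i]) k >]]%SET| = n.+1.
  rewrite (_ : [set k | _]%SET = (~: [set i])%SET).
    by rewrite cardsC1 card_ord.
  apply/setP => k; rewrite !inE; apply/asboolP/idP => /=; first by move/eqP.
  by move/eqP.
have c2 : #|[set k | `[< J k >]]%SET| = n.+1.
  by rewrite -[RHS]c1; apply/eqP; rewrite eqn_leq; apply/andP; split;
    [exact: (face_card aiq aip (esym IJ))|exact: (face_card aip aiq IJ)].
have /eqP/cards1P[j hj] : #|(~: [set k | `[< J k >]])%SET| = 1%N.
  have := cardsC [set k | `[< J k >]]%SET; rewrite c2 card_ord => e.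
  by apply: (@addnI n.+1); rewrite e addn1.
exists j; rewrite IJ /facet; congr face; apply/seteqP; split=> k.
  move=> Jk /= kj; move/setP/(_ k): hj; rewrite !inE kj eqxx => /negP; apply.
  by apply/asboolP; rewrite -kj.
move=> /= kj; apply: contrapT => nJ; apply: kj; apply/eqP.
by move/setP/(_ k): hj; rewrite !inE => <-; apply/negP => /asboolP.
Qed.

End barycentric.

(** * Common points of two elements *)

Section mesh.
Context {R : realType} {n m : nat}.
Variables (Omega : set 'rV[R]_n.+1) (T : 'I_m -> 'I_n.+2 -> 'rV[R]_n.+1).
Hypothesis meshT : conformal_mesh Omega T.

Let aiT K : affine_independent (T K).
Proof. by case: meshT. Qed.

(** The common points of two elements belong to a proper face, on which a barycentric
coordinate vanishes. *)
Lemma mesh_interior_disjoint K L x : (forall i, 0 < bary (T K) x ord0 i) ->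
  simplex (T L) x -> K = L.
Proof.
move=> xK xL; apply: contrapT => /eqP KL; have [_ _ /(_ K L KL)[I [J [IT _ E]]]] := meshT.
have : face (T K) I x.
  by rewrite -E; split=> //; apply/simplexP => // i; exact: ltW.
move=> /faceP[//|_ xI]; apply: IT; apply/seteqP; split=> // i _.
by apply: contrapT => /xI E'; have := xK i; rewrite E' ltxx.
Qed.

(** A point in the relative interior of a facet belongs to no smaller face. *)
Lemma mesh_shared_facet K L i x : K != L -> bary (T K) x ord0 i = 0 ->
  (forall j, j != i -> 0 < bary (T K) x ord0 j) -> simplex (T L) x ->
  exists j, facet (T K) i = facet (T L) j.
Proof.
move=> KL xi xj xL; have [_ _ /(_ K L KL)[I [J [IT IJ E]]]] := meshT.
have : face (T K) I x.
  rewrite -E; split=> //; apply/simplexP => // j.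
  by have [->|/xj/ltW//] := eqVneq j i; rewrite xi.
move=> /faceP[//|_ xI].
have II : I = ~` [set i].
  have sub : ~` [set i] `<=` I.
    move=> j /eqP ji; apply: contrapT => /xI E'; have := xj j ji; by rewrite E' ltxx.
  apply/seteqP; split=> // j Ij /= ji; apply: IT; apply/seteqP; split=> // k _.
  by have [->|/eqP ki] := eqVneq k i; [rewrite -ji|apply: sub].
have h : facet (T K) i = face (T L) J by rewrite /facet -II.
exact: (facet_of_face (@aiT K) (@aiT L) h).
Qed.

End mesh.

(** * General position *)

Section generic_position.
Context {R : realType} {n : nat}.
Implicit Types (x y v : 'rV[R]_n.+1).

(** There are more candidates e / (j + 2) than roots. *)
Lemma poly_small_nonroot (P : {poly R}) (e : R) : P != 0 -> 0 < e ->
  exists2 t, 0 < t < e & P.[t] != 0.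
Proof.
move=> P0 e0; pose s := [seq e / j.+2%:R | j <- iota 0 (size P)].
have us : uniq s.
  rewrite map_inj_uniq ?iota_uniq // => i j /(mulfI (lt0r_neq0 e0))/invr_inj/eqP.
  by rewrite eqr_nat => /eqP[].
have [h|] := boolP (all (root P) s).
  by have := max_poly_roots P0 h us; rewrite size_map size_iota ltnn.
rewrite -has_predC => /hasP[_ /mapP[j _ ->] h]; exists (e / j.+2%:R) => //.
by rewrite divr_gt0 ?ltr0n //= ltr_pdivrMr ?ltr0n // ltr_pMr // ltr1n.
Qed.

(** On the moment curve starting at z, each F k becomes a nonzero polynomial of the
parameter. *)
Lemma affine_generic (J : finType) (F : J -> 'rV[R]_n.+1 -> R) z (e : R) :
  (forall k, exists c a, F k = affine c a) -> (forall k, exists x, F k x != 0) ->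
  0 < e -> exists2 y, ball z e y & forall k, F k y != 0.
Proof.
move=> aF nF e0.
pose curve (t : R) : 'rV[R]_n.+1 := z + \row_b t ^+ b.+1.
have hP k : exists P : {poly R}, P != 0 /\ forall t, P.[t] = F k (curve t).
  have [c [a Fk]] := aF k; have [x Fx] := nF k.
  pose P := (affine c a z)%:P + 'X * \poly_(i < n.+1) a (inord i).
  have hPt t : P.[t] = F k (curve t).
    rewrite Fk /affine hornerD hornerC hornerM hornerX horner_poly -addrA; congr (_ + _).
    rewrite mulr_sumr -big_split /=; apply: eq_bigr => b _.
    by rewrite !mxE inord_val mulrDr exprS; ring.
  exists P; split=> //; apply: contraNneq Fx => P0.
  have a0 b : a b = 0.
    have : P`_b.+1 = 0 by rewrite P0 coef0.
    by rewrite coefD coefC /= add0r coefXM /= coef_poly ltn_ord inord_val.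
  have : P`_0 = 0 by rewrite P0 coef0.
  rewrite coefD coefC /= coefXM addr0 => c0.
  rewrite Fk -c0 /affine; apply/eqP; congr (_ + _); apply: eq_bigr => b _.
  by rewrite a0 !mul0r.
have [P hP'] := choice hP.
have Pn0 : \prod_k P k != 0 by apply/prodf_neq0 => k _; exact: (hP' k).1.
have m0 : 0 < Num.min e 1 by rewrite lt_min e0 ltr01.
have [t /andP[t0 te] Pt] := poly_small_nonroot Pn0 m0.
exists (curve t).
  apply/row_ballP; split=> // b; rewrite !mxE opprD addrA subrr sub0r normrN.
  rewrite ger0_norm ?exprn_ge0 ?ltW //; move: te; rewrite lt_min => /andP[te t1].
  by apply: le_lt_trans te; rewrite exprS ler_piMr ?exprn_ile1 // ltW.
move=> k; rewrite -(hP' k).2; move: Pt; rewrite horner_prod => /prodf_neq0; exact.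
Qed.

Lemma near0_pos (b c : R) : 0 < b -> \forall s \near (0 : R)^'+, 0 < b + s * c.
Proof.
move=> b0.
have cs : (fun s : R => b + s * c) @ (0 : R)^'+ --> b + 0 * c.
  apply: cvg_at_right_filter; apply: cvgD; first exact: cvg_cst.
  by apply: cvgM; [exact: cvg_id|exact: cvg_cst].
by rewrite mul0r addr0 in cs; exact: (cvgr_gt b cs).
Qed.

Lemma near0_path x v (A : set 'rV[R]_n.+1) : nbhs x A ->
  \forall s \near (0 : R)^'+, A (x + s *: v).
Proof.
move=> xA.
have cs : (fun s : R => x + s *: v) @ (0 : R)^'+ --> x + (0 : R) *: v.
  apply: cvg_at_right_filter; apply: cvgD; first exact: cvg_cst.
  by apply: cvgZr_tmp; exact: cvg_id.
by rewrite scale0r addr0 in cs; exact: cs.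
Qed.

Lemma fin_argmax (J : finType) (P : pred J) (f : J -> R) j0 : P j0 ->
  exists j, P j /\ forall k, P k -> f k <= f j.
Proof.
move=> Pj0; case: (Order.TotalTheory.arg_maxP f Pj0) => j Pj hj.
by exists j.
Qed.

End generic_position.

(** * Reaching the boundary of the domain *)

Section mesh_boundary.
Context {R : realType} {n m : nat}.
Variables (Omega : set 'rV[R]_n.+1) (T : 'I_m -> 'I_n.+2 -> 'rV[R]_n.+1).
Hypothesis meshT : conformal_mesh Omega T.
Implicit Types (x y v : 'rV[R]_n.+1) (K L : 'I_m).

Let aiT K : affine_independent (T K).
Proof. by case: meshT. Qed.

Let bry K := bary (T K).

Lemma simplex_closure K : simplex (T K) `<=` closure Omega.
Proof. by case: meshT => _ -> _ x xK; exists K. Qed.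

(** Suppose that a point y of the facet is in Omega. Move y to a point x in the relative
interior of the facet, then slightly out of the element, away from the opposite vertex.
The point obtained is still in Omega, thus in an element L other than K. The elements
being closed and finitely many, x itself is in such an L, which has the facet in
common with K. *)
Lemma unshared_facet_boundary K i : open Omega ->
  (forall L j, L != K -> facet (T L) j <> facet (T K) i) ->
  facet (T K) i `<=` boundary Omega.
Proof.
move=> oO uns y yF; have [y0 yi] := (facetP i y (@aiT K)).1 yF.
split; first by apply: (@simplex_closure K); exact/(simplexP _ (@aiT K)).
move=> yO.
(* z is the center of mass of the facet. *)
pose c (j : 'I_n.+2) : R := (j != i)%:R / n.+1%:R.
have c1 : \sum_j c j = 1.
  rewrite -mulr_suml (bigD1 i) //= eqxx add0r.
  rewrite (eq_bigr (fun=> 1)) => [|j ->//].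
  by rewrite sumr_const cardC1 card_ord divff // pnatr_eq0.
pose z := \sum_j c j *: T K j.
have zc := bary_uniq (@aiT K) c1 (erefl z).
have oOy : nbhs y Omega by exact: open_nbhs_nbhs.
have near1 : \forall s \near (0 : R)^'+, s < 1 by apply: nbhs_right_lt.
have near0 : \forall s \near (0 : R)^'+, 0 < s by exact: nbhs_right_gt.
have [s [[sO s1] s0]] := filter_ex (filterI (filterI (near0_path (z - y) oOy) near1) near0).
set x := y + s *: (z - y) in sO.
have bx j : bry K x ord0 j = (1 - s) * bry K y ord0 j + s * c j.
  rewrite /bry /x bary_ray dbary_sub zc; ring.
have xi : bary (T K) x ord0 i = 0 by rewrite -/(bry K) bx /bry yi /c eqxx !(mul0r, mulr0) addr0.
have xj j : j != i -> 0 < bary (T K) x ord0 j.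
  move=> ji; rewrite -/(bry K) bx /c ji ltr_wpDl ?mulr_ge0 ?y0 ?subr_ge0 ?ltW //.
  by rewrite mulr_gt0 // divr_gt0 // ltr0n.
have notL : \forall t \near (0 : R)^'+, forall L, L != K -> ~ simplex (T L) (x + t *: (x - T K i)).
  apply: filter_forall => L.
  have [->|LK] := eqVneq L K; first exact: nearW.
  suff : \forall t \near (0 : R)^'+, ~ simplex (T L) (x + t *: (x - T K i)) by apply: filterS.
  apply: (near0_path (x - T K i) (A := ~` simplex (T L))); apply: open_nbhs_nbhs; split.
    exact/closed_openC/simplex_closed.
  move=> /= xL; have KL : K != L by rewrite eq_sym.
  have [j E] := mesh_shared_facet meshT KL xi xj xL.
  exact: (uns L j LK (esym E)).
have oOx : nbhs x Omega by exact: open_nbhs_nbhs.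
have [t [[tO tL] t0]] := filter_ex (filterI (filterI (near0_path (x - T K i) oOx) notL) near0).
have [_ cov _] := meshT.
have : closure Omega (x + t *: (x - T K i)) by exact: subset_closure.
rewrite cov => -[L _ xL]; have [LK|/tL//] := eqVneq L K.
move: xL; rewrite LK => /(simplexP _ (@aiT K))/(_ i).
rewrite bary_ray dbary_sub xi bary_vertex // eqxx => h.
by move: h; rewrite add0r sub0r mulrN1 oppr_ge0 leNgt t0.
Qed.

(** Follow a line from an interior point of L0, in general position: two barycentric
coordinates for the same element never vanish simultaneously. Consider the last time
at which it leaves an element K of C, through the relative interior of a facet. If L
has the same facet, then L is in C. Either the line enters L, and it leaves C later; or
it leaves L at the same time, and just before it was interior to both K and L. *)
Lemma exit_facet (C : pred 'I_m) L0 : C L0 ->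
  (forall K L i j, K != L -> C K -> facet (T K) i = facet (T L) j -> C L) ->
  exists K i, C K /\ forall L j, L != K -> facet (T L) j <> facet (T K) i.
Proof.
move=> CL0 closedC.
have baryE K i : exists c a, (fun x => bry K x ord0 i) = affine c a.
  exists (usubmx (bary_mx (T K)) ord0 i), (fun b => dsubmx (bary_mx (T K)) b i).
  apply/funext => x; rewrite /affine /bry /bary mxE [dbary _ _ _ _]mxE; congr (_ + _).
  by apply: eq_bigr => b _; rewrite mulrC.
pose c0 (j : 'I_n.+2) : R := n.+2%:R^-1.
have c01 : \sum_j c0 j = 1 by rewrite /c0 sumr_const card_ord -[LHS]mulr_natr mulVf ?pnatr_eq0.
have zc := bary_uniq (@aiT L0) c01 (erefl (\sum_j c0 j *: T L0 j)).
set z := \sum_j c0 j *: T L0 j in zc.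
have nz : nbhs z (fun x => forall i, 0 < bry L0 x ord0 i).
  apply: (@filter_forall _ 'I_n.+2 (fun i x => 0 < bry L0 x ord0 i) (nbhs z)) => i.
  have := @bary_continuous _ _ (T L0) i z; move/cvgr_gt; apply.
  by rewrite zc invr_gt0 ltr0n.
have /nbhs_ballP[e /= e0 he] := nz.
pose F0 (k : 'I_m * 'I_n.+2) x : R := bry k.1 x ord0 k.2.
have aF0 k : exists c a, F0 k = affine c a by exact: (baryE k.1 k.2).
have nF0 k : exists x, F0 k x != 0.
  by exists (T k.1 k.2); rewrite /F0 /bry bary_vertex // eqxx oner_eq0.
have [y0 /he y0L0 al0] := affine_generic z aF0 nF0 e0.
(* Along the line y0 + t v, the i-th coordinate for K is al K i + t * be K v i. *)
pose al K i := bry K y0 ord0 i.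
pose be K v i := dbary (T K) v ord0 i.
(* F (K, (i, j)) v is zero when the i-th and j-th coordinates vanish together on
   the line of direction v; the value 1 discards the case i = j. *)
pose F (k : 'I_m * ('I_n.+2 * 'I_n.+2)) v :=
  if k.2.1 == k.2.2 then 1 else al k.1 k.2.1 * be k.1 v k.2.2 - al k.1 k.2.2 * be k.1 v k.2.1.
have aF k : exists c a, F k = affine c a.
  case: k => K [i j]; rewrite /F /=; case: (eqVneq i j) => [_|ij].
    by exists 1, (fun=> 0); rewrite -cst_affine.
  exists 0, (fun b => al K i * dsubmx (bary_mx (T K)) b j - al K j * dsubmx (bary_mx (T K)) b i).
  apply/funext => v; rewrite /affine add0r /be /dbary !mxE !mulr_sumr -sumrB.
  by apply: eq_bigr => b _; ring.
have nF k : exists v, F k v != 0.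
  case: k => K [i j]; rewrite /F /=; case: (eqVneq i j) => [_|ij].
    by exists 0; rewrite oner_eq0.
  exists (T K j - y0); rewrite /be !dbary_sub !bary_vertex // eqxx (negbTE ij).
  rewrite (_ : _ - _ = al K i); first exact: (al0 (K, i)).
  by rewrite -[true%:R]/(1 : R) -[false%:R]/(0 : R) /al /bry; ring.
have [th _ hth] := affine_generic 0 aF nF (ltr01 : 0 < 1 :> R).
pose b K i := be K th i.
pose y (t : R) := y0 + t *: th.
have byt K i t : bry K (y t) ord0 i = al K i + t * b K i.
  by rewrite /bry /y bary_ray.
have gen K i j t : i != j -> bry K (y t) ord0 i = 0 -> bry K (y t) ord0 j = 0 -> False.
  move=> ij; rewrite !byt => /eqP; rewrite addr_eq0 => /eqP Ei /eqP; rewrite addr_eq0 => /eqP Ej.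
  have := hth (K, (i, j)); rewrite /F /= (negbTE ij) -/(b K i) -/(b K j) Ei Ej => /eqP; apply.
  by ring.
have al_neq0 K i : al K i != 0 := al0 (K, i).
have ybe K i t : bry K (y t) ord0 i = 0 -> b K i != 0.
  by rewrite byt => E; apply/eqP => b0; move/eqP: E; rewrite b0 mulr0 addr0; exact/negP/al_neq0.
have bsum K : \sum_i b K i = 0.
  have := bary_sum (y0 + th) (@aiT K); rewrite baryD.
  under eq_bigr do rewrite mxE.
  by rewrite big_split /= bary_sum // => /eqP; rewrite -subr_eq0 addrAC subrr add0r => /eqP.
(* The time at which the i-th coordinate for K vanishes. *)
pose tt K i := - al K i / b K i.
have ttE K i : b K i != 0 -> al K i + tt K i * b K i = 0.
  by move=> b0; rewrite /tt divfK // subrr.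
have exit_time K t0 : simplex (T K) (y t0) ->
    exists i, [/\ b K i < 0, t0 <= tt K i & simplex (T K) (y (tt K i))].
  move=> /(simplexP _ (@aiT K)) ht0.
  have [i0 bi0] : exists i, b K i < 0.
    apply: contrapT => /forallNP h.
    have bge0 i : 0 <= b K i by rewrite leNgt; apply/negP; exact: h.
    have b0 i : b K i = 0.
      have /eqP := bsum K; rewrite psumr_eq0 // => /allP/(_ i).
      by rewrite mem_index_enum => /(_ isT)/eqP.
    have := hth (K, (ord0, ord_max)); rewrite /F /= -/(b K ord0) -/(b K ord_max) !b0 !mulr0 subrr.
    by rewrite eqxx.
  have [i [bi hi]] := @fin_argmax R _ (fun i => b K i < 0) (fun i => - tt K i) i0 bi0.
  have t0i j : b K j < 0 -> t0 <= tt K j.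
    move=> bj; have := ht0 j; rewrite -/(bry K) byt => h.
    by rewrite /tt ler_ndivlMr // -[leRHS]add0r -subr_ge0 opprK add0r addrC.
  exists i; split=> //; first exact: t0i.
  apply/(simplexP _ (@aiT K)) => j; rewrite -/(bry K) byt.
  have [bj|bj] := leP 0 (b K j).
    have := ht0 j; rewrite -/(bry K) byt => /le_trans; apply.
    by rewrite lerD2l ler_wpM2r // t0i.
  apply: (@le_trans _ _ (al K j + tt K j * b K j)); first by rewrite ttE ?ltr0_neq0.
  by rewrite lerD2l; apply: ler_wnM2r; [exact: ltW|rewrite -lerN2; exact: hi].
(* The line leaves k.1, an element of C, when its coordinate k.2 vanishes. *)
pose P (k : 'I_m * 'I_n.+2) := [&& C k.1, b k.1 k.2 < 0 & `[< simplex (T k.1) (y (tt k.1 k.2)) >]].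
have [k0 Pk0] : exists k, P k.
  have [|i [bi _ yi]] := exit_time L0 0.
    rewrite /y scale0r addr0; apply/(simplexP _ (@aiT L0)) => i; exact/ltW/y0L0.
  by exists (L0, i); rewrite /P /= CL0 bi; exact/asboolP.
have [[K i] [/and3P[/= CK bi /asboolP yK] hmax]] := fin_argmax (fun k => tt k.1 k.2) Pk0.
exists K, i; split=> // L j LK E.
have CL : C L by apply: (closedC K L i j) => //; rewrite eq_sym.
set ts := tt K i in yK hmax.
have Ki0 : bry K (y ts) ord0 i = 0 by rewrite byt ttE // ltr0_neq0.
have Kpos k : k != i -> 0 < bry K (y ts) ord0 k.
  move=> ki; rewrite lt_def ((simplexP _ (@aiT K)).1 yK) andbT.
  by apply/eqP => E'; exact: (gen K k i ts ki).
have [Lge0 Lj0] : (forall i, 0 <= bary (T L) (y ts) ord0 i) /\ bary (T L) (y ts) ord0 j = 0.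
  apply/(facetP j (y ts) (@aiT L)); rewrite E; apply/(facetP i _ (@aiT K)); split=> //.
  exact: (simplexP _ (@aiT K)).1 yK.
have Lpos k : k != j -> 0 < bry L (y ts) ord0 k.
  by move=> kj; rewrite lt_def Lge0 andbT; apply/eqP => E'; exact: (gen L k j ts kj).
have near0 : \forall s \near (0 : R)^'+, 0 < s by exact: nbhs_right_gt.
have yD s : y ts + s *: th = y (ts + s) by rewrite /y -addrA -scalerDl.
have hs c (M : 'I_m) l : (forall k, k != l -> 0 < bry M (y ts) ord0 k) -> bry M (y ts) ord0 l = 0 ->
   0 < c * b M l -> \forall s \near (0 : R)^'+, forall k, 0 < bry M (y (ts + s * c)) ord0 k.
  move=> hpos h0 cb; apply: (@filter_forall _ 'I_n.+2 (fun k s => 0 < bry M (y (ts + s * c)) ord0 k) ((0 : R)^'+)) => k.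
  have E' s : bry M (y (ts + s * c)) ord0 k = bry M (y ts) ord0 k + s * (c * b M k).
    by rewrite !byt; ring.
  have [->|kl] := eqVneq k l.
    by apply: filterS near0 => s s0; rewrite byt mulrDl addrA -byt h0 add0r -mulrA mulr_gt0.
  apply: filterS (near0_pos (c * b M k) (hpos k kl)) => s; by rewrite E'.
(* The line enters L, or leaves it, or is parallel to the facet. *)
have [bj|bj|bj] := ltgtP 0 (b L j).
- have hL := hs 1 L j Lpos Lj0; rewrite mul1r in hL.
  have [s [sL s0]] := filter_ex (filterI (hL bj) near0).
  have [|i' [bi' ti' yi']] := exit_time L (ts + s * 1).
    by apply/(simplexP _ (@aiT L)) => k; exact/ltW/sL.
  have := hmax (L, i'); rewrite /P /= CL bi' /= => /(_ (introT (asboolP _) yi')) h.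
  by have := le_trans ti' h; rewrite mulr1 gerDl leNgt s0.
- have hL := hs (-1) L j Lpos Lj0; have hK := hs (-1) K i Kpos Ki0.
  rewrite !mulN1r !oppr_gt0 in hL hK.
  have [s [sL sK]] := filter_ex (filterI (hL bj) (hK bi)).
  have := mesh_interior_disjoint meshT sK (L := L); move=> KL.
  have KL' : K = L by apply: KL; apply/(simplexP _ (@aiT L)) => k; exact/ltW/sL.
  by move: LK; rewrite KL' eqxx.
by have := ybe L j ts Lj0; rewrite -bj eqxx.
Qed.

(** Among the vertices of the elements where w takes the value c L, choose one of largest
first coordinate. If it is in Omega, then moving slightly further in the first
direction leads to an element where w takes the same value by continuity, but all the
vertices of which are behind. *)
Lemma piecewise_constant_continuous (c : 'I_m -> R) (w : 'rV[R]_n.+1 -> R) :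
  open Omega -> {within Omega, continuous w} ->
  (forall K x, simplex (T K) x -> Omega x -> w x = c K) ->
  (forall K i, boundary Omega (T K i) -> c K = 0) -> forall K, c K = 0.
Proof.
move=> oO cw wc cbd L.
have [[K i] [/= /eqP cK hmax]] := @fin_argmax R _ (fun k : 'I_m * 'I_n.+2 => c k.1 == c L)
  (fun k => T k.1 k.2 ord0 ord0) (L, ord0) (eqxx _).
rewrite -cK; have TKi : simplex (T K) (T K i) by exact: vertex_face.
apply: (cbd K i); split; first exact: simplex_closure TKi.
move=> xO; set x := T K i in xO TKi.
have oOx : nbhs x Omega by exact: open_nbhs_nbhs.
have wx : w @ x --> w x.
  by move: cw; rewrite (continuous_open_subspace w oO) => /(_ x); apply; rewrite inE.
have near_ne : \forall y \near x, forall M, c M != c L -> w y != c M.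
  apply: (@filter_forall _ 'I_m (fun M y => c M != c L -> w y != c M) (nbhs x)) => M; have [E|ne] := eqVneq (c M) (c L); first exact: nearW.
  suff : \forall y \near x, w y != c M by apply: filterS.
  have : w x != c M by rewrite (wc K) // cK eq_sym.
  rewrite -subr_eq0 -normr_gt0 => d0.
  move/cvgrPdist_lt: wx => /(_ _ d0); apply: filterS => y; apply: contraTneq => ->.
  by rewrite ltxx.
have near0 : \forall s \near (0 : R)^'+, 0 < s by exact: nbhs_right_gt.
pose e0 : 'rV[R]_n.+1 := delta_mx ord0 ord0.
have [s [[sO sne] s0]] := filter_ex (filterI (filterI (near0_path e0 oOx) (near0_path e0 near_ne)) near0).
have [_ cov _] := meshT.
have : closure Omega (x + s *: e0) by exact: subset_closure.
rewrite cov => -[M _ xM].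
have cM : c M = c L.
  by apply/eqP; apply: contraT => /sne; rewrite (wc M) // eqxx.
move: xM => [l [l0 _ l1 /rowP/(_ ord0)]]; rewrite !mxE !eqxx mulr1 => E.
have : x ord0 ord0 + s <= x ord0 ord0.
  rewrite E summxE -[leRHS]mul1r -l1 mulr_suml; apply: ler_sum => j _.
  by rewrite mxE ler_wpM2l //; apply: (hmax (M, j)); rewrite /= cM.
by rewrite gerDl leNgt s0.
Qed.

End mesh_boundary.

(** * Linear combinations *)

Section linear_combinations.
Context {R : realType} {n m : nat}.

(** Degrees of freedom, loads and forms are only linear on a class of functions, so
linearity is assumed on a set closed under linear combinations. *)
Lemma linear_lincomb (W : set (broken R n m)) (l : broken R n m -> R) :
  W (fun _ _ => 0) ->
  (forall c u v, W u -> W v -> W (fun K x => c * u K x + v K x) /\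
     l (fun K x => c * u K x + v K x) = c * l u + l v) ->
  forall N (c : 'I_N -> R) b, (forall j, W (b j)) ->
  W (lincomb c b) /\ l (lincomb c b) = \sum_j c j * l (b j).
Proof.
move=> W0 Wlin.
have l0 : l (fun _ _ => 0) = 0.
  have [_ ] := Wlin 1 _ _ W0 W0.
  rewrite (_ : (fun _ _ => 1 * 0 + 0) = (fun _ _ => 0)); last first.
    by apply/funext => K; apply/funext => x; rewrite mul1r addr0.
  by rewrite mul1r => /eqP; rewrite -subr_eq0 opprD addrA subrr sub0r oppr_eq0 => /eqP.
elim=> [|N IH] c b Wb.
  rewrite big_ord0 (_ : lincomb c b = (fun _ _ => 0)) //.
  by apply/funext => K; apply/funext => x; rewrite /lincomb big_ord0.
have [Wr lr] := IH (fun j => c (lift ord0 j)) (fun j => b (lift ord0 j)) (fun j => Wb _).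
have [W1 l1] := Wlin (c ord0) _ _ (Wb ord0) Wr.
rewrite big_ord_recl -lr -l1.
rewrite (_ : lincomb c b = (fun K x => c ord0 * b ord0 K x +
  lincomb (fun j => c (lift ord0 j)) (fun j => b (lift ord0 j)) K x)) //.
by apply/funext => K; apply/funext => x; rewrite /lincomb big_ord_recl.
Qed.

End linear_combinations.

(** Functions are broken functions on a mesh with a single element. *)
Lemma linear_sum (R : realType) (n : nat) (W : set ('rV[R]_n.+1 -> R))
    (l : ('rV[R]_n.+1 -> R) -> R) :
  W (fun=> 0) ->
  (forall c u v, W u -> W v -> W (fun x => c * u x + v x) /\
     l (fun x => c * u x + v x) = c * l u + l v) ->
  forall N (c : 'I_N -> R) b, (forall j, W (b j)) ->
  W (fun x => \sum_j c j * b j x) /\ l (fun x => \sum_j c j * b j x) = \sum_j c j * l (b j).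
Proof.
move=> W0 Wlin N c b Wb.
apply: (@linear_lincomb R n 1 (fun u => W (u ord0)) (fun u => l (u ord0)) W0 _ N c (fun j _ => b j)) => //.
by move=> c' u v Wu Wv; exact: Wlin.
Qed.

(** * Multiscale functions on one element *)

Section element.
Context {R : realType} {n : nat}.
Implicit Types (u v w : 'rV[R]_n.+1 -> R).

Lemma P1_lin c u v : P1 u -> P1 v -> P1 (fun x => c * u x + v x).
Proof.
move=> [d [a ->]] [d' [a' ->]]; exists (c * d + d'), (fun b => c * a b + a' b).
apply/funext => x; rewrite mulrDr addrACA mulr_sumr -big_split /=; congr (_ + _).
by apply: eq_bigr => b _; ring.
Qed.

Lemma P1_0 : P1 ((fun=> 0) : 'rV[R]_n.+1 -> R).
Proof. by exists 0, (fun=> 0); rewrite -/(affine _ _) -cst_affine. Qed.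

Lemma P1_continuous u : P1 u -> continuous u.
Proof. by move=> [c [a ->]]; exact: affine_continuous. Qed.

Lemma dof_P1_lin k (p : 'I_n.+2 -> 'rV[R]_n.+1) i c u v : P1 u -> P1 v ->
  dof_P1 k p (fun x => c * u x + v x) i = c * dof_P1 k p u i + dof_P1 k p v i.
Proof.
move=> /P1_continuous cu /P1_continuous cv; case: k => //=.
by rewrite facet_mean_lin //; exact: facet_param_L2.
Qed.

(** The coefficients of the Taylor expansion of v at the centroid, indexed as
[corrector_data]. *)
Definition corrector_coef (p : 'I_n.+2 -> 'rV[R]_n.+1) v (al : 'I_n.+2) : R :=
  if unlift ord0 al is Some b then partial b v (centroid p) else v (centroid p).

(** The factor 1 gives the function the form c u + v to which linearity applies. *)
Definition add_correctors (p : 'I_n.+2 -> 'rV[R]_n.+1)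
    (chi : 'I_n.+2 -> 'rV[R]_n.+1 -> R) v : 'rV[R]_n.+1 -> R :=
  fun x => 1 * v x + \sum_al corrector_coef p v al * chi al x.

Lemma multiscaleE m (T : 'I_m -> 'I_n.+2 -> 'rV[R]_n.+1) chi phi K :
  multiscale T chi phi K = add_correctors (T K) (chi K) (phi K).
Proof.
apply/funext => x; rewrite /multiscale /add_correctors [in RHS]big_ord_recl mul1r addrA.
rewrite {1}/corrector_coef unlift_none; congr (_ + _).
by apply: eq_bigr => b _; rewrite /corrector_coef liftK.
Qed.

Lemma P1_taylor p v : P1 v ->
  v = (fun x => \sum_al corrector_coef p v al * corrector_data p al x).
Proof.
move=> [c [a ->]]; rewrite -/(affine c a); apply/funext => x.
rewrite big_ord_recl {1}/corrector_coef {1}/corrector_data unlift_none mulr1.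
rewrite {1 2}/affine -addrA -big_split /=; congr (_ + _); apply: eq_bigr => b _.
by rewrite /corrector_coef /corrector_data liftK partial_affine /=; ring.
Qed.

Lemma corrector_data_P1 p al : P1 (corrector_data p al : 'rV[R]_n.+1 -> R).
Proof.
rewrite /corrector_data; case: unlift => [b|]; last first.
  by rewrite cst_affine; exists 1, (fun=> 0).
exists (- centroid p ord0 b), (fun b' => (b' == b)%:R); apply/funext => x.
rewrite (bigD1 b) //= eqxx mul1r big1 ?addr0 1?addrC // => b' /negbTE ->.
by rewrite mul0r.
Qed.

Context (k : msfem) (p : 'I_n.+2 -> 'rV[R]_n.+1) (V : set ('rV[R]_n.+1 -> R)).
Hypothesis spaceV : sampling_space k p V.

Let VH1 : V `<=` H1 (simplex p)°. Proof. by case: spaceV. Qed.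
Let Vlin c u v : V u -> V v -> V (fun x => c * u x + v x). Proof. by case: spaceV => _ + _ _ _; exact. Qed.
Let P1V v : P1 v -> V v. Proof. by case: spaceV => _ _ _ + _; exact. Qed.
Let V0 : V (fun=> 0). Proof. by apply: P1V; exact: P1_0. Qed.

Lemma dofP v i : V v -> is_dof k p v i (dof k p v i).
Proof. by case: spaceV => _ _ _ _ /(_ v i) + Vv => /(_ Vv) [y [yP _]]; apply: getPex; exists y. Qed.

Lemma dof_uniq v i y : V v -> is_dof k p v i y -> dof k p v i = y.
Proof.
move=> Vv vy; case: spaceV => _ _ _ _ /(_ v i Vv) [z [_ zu]].
by rewrite -(zu _ vy); apply/esym/zu/dofP.
Qed.

Lemma dof_lin i c u v : V u -> V v ->
  dof k p (fun x => c * u x + v x) i = c * dof k p u i + dof k p v i.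
Proof.
by move=> Vu Vv; apply: dof_uniq; [exact: Vlin|apply: is_dof_lin; exact: dofP].
Qed.

Lemma dof_P1E v i : P1 v -> dof k p v i = dof_P1 k p v i.
Proof. by move=> Pv; apply: dof_uniq; [exact: P1V|exact: is_dof_P1]. Qed.

(** A degree of freedom provides a trace, so the function is constant; the degrees of
freedom of a constant are equal to it. *)
Lemma dof_grad0 v : V v ->
  (forall g, weak_grad (simplex p)° v g -> forall b, L2norm (simplex p)° (g b) = 0) ->
  exists c, forall i, dof k p v i = c.
Proof.
move=> Vv g0.
(* For MsFEM-lin, the value at the vertex ord0 is that of the traces on the facets
   other than ord0, the only ones containing this vertex. *)
have [j [h hj]] : exists j h, is_trace p j v h.
  have := dofP ord0 Vv; case: k => /= [/(_ ord_max isT)[h hj _]|[h hj _]].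
    by exists ord_max, h.
  by exists ord0, h.
have [c vc] := is_trace_grad0_cst hj g0.
exists c => i; apply: dof_uniq => //; apply: is_dof_ae_cst vc.
by have [] := VH1 Vv.
Qed.

Context (s : ('rV[R]_n.+1 -> R) -> ('rV[R]_n.+1 -> R) -> R)
  (chi : 'I_n.+2 -> 'rV[R]_n.+1 -> R).
Hypotheses (bils : bilinear_on V s) (corr : correctors k p V s chi).

Let chiV al : V (chi al). Proof. by have [[]] := corr al. Qed.

Lemma bilinear_sum N (c : 'I_N -> R) b w : (forall j, V (b j)) -> V w ->
  [/\ V (fun x => \sum_j c j * b j x),
      s (fun x => \sum_j c j * b j x) w = \sum_j c j * s (b j) w
    & s w (fun x => \sum_j c j * b j x) = \sum_j c j * s w (b j)].
Proof.
move=> Vb Vw.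
have [|Vs sl] := linear_sum (l := fun u => s u w) V0 _ c Vb.
  by move=> d u v Vu Vv; split; [exact: Vlin|exact: (bils d Vu Vv Vw).1].
have [|_ sr] := linear_sum (l := fun u => s w u) V0 _ c Vb.
  by move=> d u v Vu Vv; split; [exact: Vlin|exact: (bils d Vu Vv Vw).2].
by [].
Qed.

Lemma add_correctors_V v : P1 v -> V (add_correctors p chi v).
Proof.
move=> /P1V Vv; apply: Vlin => //.
by case: (bilinear_sum (corrector_coef p v) chiV V0).
Qed.

Lemma dof_add_correctors v i : P1 v -> dof k p (add_correctors p chi v) i = dof_P1 k p v i.
Proof.
move=> Pv; have Vv := P1V Pv.
have [|Vs ds] := linear_sum (l := fun u => dof k p u i) V0 _ (corrector_coef p v) chiV.
  by move=> d u u' Vu Vu'; split; [exact: Vlin|exact: dof_lin].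
rewrite dof_lin // ds mul1r dof_P1E // big1 ?addr0 // => al _.
by have [[_ ->] _] := corr al; rewrite mulr0.
Qed.

(** Expand v at the centroid: the equation of each corrector cancels one term. *)
Lemma add_correctors_orth v w : P1 v -> kernel_space k V p w ->
  s (add_correctors p chi v) w = 0.
Proof.
move=> Pv kw; have Vw := kw.1; have Vv := P1V Pv.
have [Vs sl _] := bilinear_sum (corrector_coef p v) chiV Vw.
rewrite /add_correctors (bils 1 Vv Vs Vw).1 mul1r sl [in s v w](P1_taylor p Pv).
have Vd al : V (corrector_data p al) by apply: P1V; exact: corrector_data_P1.
have [_ -> _] := bilinear_sum (corrector_coef p v) Vd Vw.
rewrite -big_split big1 //= => al _.
by rewrite (corr al).2 // mulrN addrN.
Qed.

(** The correctors, by which the two arguments on the right differ, are in the kernel of the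
degrees of freedom. *)
Lemma add_correctors_formr u v : P1 u -> P1 v ->
  s (add_correctors p chi u) (add_correctors p chi v) = s (add_correctors p chi u) v.
Proof.
move=> Pu Pv; have Vu := add_correctors_V Pu; have Vv := P1V Pv.
have [Vs _ sr] := bilinear_sum (corrector_coef p v) chiV Vu.
rewrite [X in s _ X]/add_correctors (bils 1 Vv Vs Vu).2 mul1r sr big1 ?addr0 // => al _.
by rewrite add_correctors_orth ?mulr0 //; case: (corr al).
Qed.

End element.

(** * Unisolvence of the degrees of freedom *)

Section unisolvence.
Context {R : realType} {n : nat}.
Implicit Types (p : 'I_n.+2 -> 'rV[R]_n.+1) (v : 'rV[R]_n.+1 -> R).

Lemma dof_support_inj k p : affine_independent p -> injective (dof_support k p).
Proof.
move=> aip; case: k => i j /=; first by rewrite eqEsubset => -[/(_ _ erefl)/(vertex_inj aip)].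
move=> E; apply/eqP; apply: contraT => ij.
have : facet p j (p i) by apply: vertex_face => /= ji; rewrite ji eqxx in ij.
by rewrite -/(facet p j) -E => /(facetP _ _ aip)[_]; rewrite bary_vertex // eqxx => /eqP; rewrite oner_eq0.
Qed.

(** The matrix of coefficients of the B i is square, as there are as many degrees of freedom
as coefficients in P1, and duality makes its kernel trivial. So the B i span P1. *)
Lemma P1_dual_expansion k p (B : 'I_n.+2 -> 'rV[R]_n.+1 -> R) :
  (forall i, P1 (B i)) -> (forall i j, dof_P1 k p (B i) j = (i == j)%:R) ->
  forall v, P1 v -> v = (fun x => \sum_i dof_P1 k p v i * B i x).
Proof.
move=> PB dB.
have dsum (u : 'I_n.+2 -> R) j : dof_P1 k p (fun x => \sum_i u i * B i x) j = u j.
  have [|_ ->] := linear_sum (W := P1) (l := fun v => dof_P1 k p v j) P1_0 _ u PB.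
    by move=> c v w Pv Pw; split; [exact: P1_lin|exact: dof_P1_lin].
  rewrite (bigD1 j) //= dB eqxx mulr1 big1 ?addr0 // => i /negbTE ij.
  by rewrite dB ij mulr0.
have /choice[c cE] : forall i, exists c : R, exists a, B i = affine c a.
  by move=> i; have [c [a h]] := PB i; exists c, a.
have [a aE] := choice cE.
(* The i-th row of M contains the coefficients of B i. *)
pose M : 'M[R]_(n.+2, 1 + n.+1) := row_mx (\matrix_(i < n.+2, j < 1) c i) (\matrix_(i, b) a i b).
have comb (u : 'rV[R]_n.+2) d e : u *m M = row_mx (const_mx d : 'rV_1) (\row_b e b) ->
    (fun x => \sum_i u ord0 i * B i x) = affine d e.
  rewrite mul_mx_row => /eq_row_mx[/rowP/(_ ord0) Ed /rowP Ee].
  apply/funext => x; rewrite /affine.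
  under eq_bigr do rewrite aE /affine mulrDr mulr_sumr.
  rewrite big_split /=; congr (_ + _).
    by move: Ed; rewrite !mxE => <-; apply: eq_bigr => i _; rewrite mxE.
  rewrite exchange_big /=; apply: eq_bigr => b _.
  move: (Ee b); rewrite !mxE => <-; rewrite mulr_suml.
  by apply: eq_bigr => i _; rewrite mxE mulrA.
have uM : (M : 'M[R]_n.+2) \in unitmx.
  rewrite -row_free_unit -kermx_eq0; apply/rowV0P => u /sub_kermxP u0.
  have : u *m M = row_mx (const_mx 0 : 'rV_1) (\row_b (fun=> 0) b).
    have E : u *m M = 0 by exact: u0.
    by rewrite E -row_mx0; congr row_mx; apply/matrixP => i j; rewrite !mxE.
  move/comb => E; apply/rowP => i; rewrite mxE -(dsum (fun i => u ord0 i) i) E.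
  by rewrite -cst_affine dof_P1_cst.
move=> v [d [e vE]].
pose u : 'rV[R]_n.+2 := (row_mx (const_mx d : 'rV_1) (\row_b e b) : 'rV_(1 + n.+1)) *m invmx (M : 'M[R]_n.+2).
have uv : (fun x => \sum_i u ord0 i * B i x) = v.
  rewrite vE; apply: comb; exact: mulmxKV.
rewrite -[LHS]uv; apply/funext => x; apply: eq_bigr => i _.
by rewrite -uv dsum.
Qed.

End unisolvence.

(** * Piecewise constant functions of the discrete space *)

Section broken_space.
Context {R : realType} {n m : nat}.
Variables (k : msfem) (Omega : set 'rV[R]_n.+1) (T : 'I_m -> 'I_n.+2 -> 'rV[R]_n.+1).
Implicit Types (u v : broken R n m).

Lemma VH_lin c u v : VH k Omega T u -> VH k Omega T v ->
  VH k Omega T (fun K x => c * u K x + v K x).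
Proof.
move=> [Pu hu] [Pv hv]; split; first by move=> K; exact: P1_lin.
case: k hu hv => [[w cw wu] [z cz zv]|hu hv].
  exists (fun x => c * w x + z x).
    by move=> x; exact: (cvgD (cvgM (cvg_cst c) (cw x)) (cz x)).
  by move=> K x Kx Ox; rewrite (wu K) // (zv K).
move=> K L i j KL E.
have cL2 (f : broken R n m) K' : (forall K, P1 (f K)) -> L2 ref_simplex (f K' \o facet_param (T K) i).
  by move=> Pf; apply: facet_param_L2; exact: P1_continuous.
rewrite (_ : (fun x => _) = (fun x => c * (u K x - u L x) + (v K x - v L x))); last first.
  by apply/funext => x; ring.
rewrite facet_int_lin; first by rewrite (hu _ _ _ _ KL E) (hv _ _ _ _ KL E) mulr0 addr0.
  exact: (L2B (cL2 _ K Pu) (cL2 _ L Pu)).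
exact: (L2B (cL2 _ K Pv) (cL2 _ L Pv)).
Qed.

Lemma VH0_lin c u v : VH0 k Omega T u -> VH0 k Omega T v ->
  VH0 k Omega T (fun K x => c * u K x + v K x).
Proof.
move=> [Vu u0] [Vv v0]; split; first exact: VH_lin.
move=> K i bKi; rewrite dof_P1_lin; [|by case: Vu|by case: Vv].
by rewrite u0 // v0 // mulr0 addr0.
Qed.

Lemma VH0_0 : VH0 k Omega T (fun _ _ => 0).
Proof.
split; last by move=> K i _; exact: dof_P1_cst.
split; first by move=> K; exact: P1_0.
case: k; first by exists (fun=> 0) => // x; exact: cvg_cst.
move=> K L i j _ _; rewrite (_ : (fun x => _) = cst 0); last by apply/funext => x; rewrite subr0.
have := @dof_P1_cst R n MsFEM_CR (T K) i 0; rewrite /= /facet_mean => /eqP.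
by rewrite mulf_eq0 invr_eq0 (gt_eqF (facet_int1_gt0 _ _)) orbF => /eqP.
Qed.

Lemma VH0_P1 v K : VH0 k Omega T v -> P1 (v K).
Proof. by case=> -[]. Qed.

(** The value of v is a boundary degree of freedom, hence zero, on the elements touching
the boundary by a vertex or by a face; it remains to reach such an element from any
other one while v keeps the same value. *)
Lemma VH0_piecewise_constant v (c : 'I_m -> R) : open Omega -> conformal_mesh Omega T ->
  VH0 k Omega T v -> (forall K, v K = cst (c K)) -> forall K, c K = 0.
Proof.
move=> oO meshT [[_ hv] v0] vc.
have bd K i : dof_support k (T K) i `<=` boundary Omega -> c K = 0.
  by move/v0; rewrite vc dof_P1_cst.
case: k hv bd {v0} => [[w cw wv] bd|hv bd].
  apply: (piecewise_constant_continuous meshT oO cw).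
    by move=> K x Kx Ox; rewrite (wv K) // vc.
  by move=> K i bKi; apply: (bd K i) => _ ->.
move=> L0; have [|K L i j KL /eqP cK E|K [i [/eqP <- uns]]] := exit_facet meshT (C := fun K => c K == c L0) (L0 := L0).
- by rewrite eqxx.
- rewrite -cK eq_sym -subr_eq0; apply/eqP; have := hv _ _ _ _ KL E.
  rewrite (_ : (fun x => _) = cst (c K - c L)); last by rewrite !vc.
  by move=> I0; rewrite -(@dof_P1_cst R n MsFEM_CR (T K) i (c K - c L)) /= /facet_mean I0 mul0r.
- by apply: (bd K i); exact: unshared_facet_boundary.
Qed.

(** The functions of the dual basis attached to the vertices or faces of K restrict to a
dual basis on K. *)
Lemma dof_P1_cst_inv N (D : 'I_N -> set 'rV[R]_n.+1) (phi : 'I_N -> broken R n m) K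
    (w : 'rV[R]_n.+1 -> R) c :
  affine_independent (T K) -> dof_enumeration k T D -> dual_to k T D phi ->
  (forall j, P1 (phi j K)) -> P1 w -> (forall i, dof_P1 k (T K) w i = c) -> w = cst c.
Proof.
move=> aiK [_ DE] dual Pphi Pw wc.
have /choice[s sE] : forall i, exists j, D j = dof_support k (T K) i.
  move=> i; have : range D (dof_support k (T K) i) by rewrite DE; exists K, i.
  by case=> j _ <-; exists j.
have ex := @P1_dual_expansion R n k (T K) (fun i => phi (s i) K) (fun i => Pphi _) _.
rewrite [LHS]ex //; last first.
  move=> i j; rewrite dual sE; congr (_%:R : R); congr nat_of_bool.
  apply/asboolP/eqP => [/(dof_support_inj aiK)//|->//].
rewrite [RHS]ex //; first by apply/funext => x; apply: eq_bigr => i _; rewrite wc dof_P1_cst.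
  move=> i j; rewrite dual sE; congr (_%:R : R); congr nat_of_bool.
  apply/asboolP/eqP => [/(dof_support_inj aiK)//|->//].
by exists c, (fun=> 0); rewrite -/(affine _ _) -cst_affine.
Qed.

End broken_space.

(** * The right-hand side *)

Section load.
Context {R : realType} {n m : nat}.
Variables (Omega : set 'rV[R]_n.+1) (T : 'I_m -> 'I_n.+2 -> 'rV[R]_n.+1)
  (f : 'rV[R]_n.+1 -> R).
Hypotheses (oO : open Omega) (meshT : conformal_mesh Omega T) (fL2 : L2 Omega f).

Let mO : measurable Omega. Proof. exact: open_measurable_row. Qed.

Let mesh_finite : (lebesgue_row n.+1 Omega < +oo)%E.
Proof.
have /choice[M hM] K := simplex_bounded (T K).
have M0 K : 0 <= M K.
  apply: le_trans (hM K (T K ord0) _ ord0) => //; exact: vertex_face.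
apply: (finite_measure_bounded (M := \sum_K M K) mO) => x Ox i.
have [_ E _] := meshT; have : closure Omega x by exact: subset_closure.
rewrite E => -[K _ xK]; apply: le_trans (hM K x xK i) _.
by rewrite (bigD1 K) //= lerDl sumr_ge0.
Qed.

(** It is bounded, and Omega has finite measure. *)
Lemma glue_L2 (v : broken R n m) : (forall K, P1 (v K)) -> L2 Omega (Defs.glue T v).
Proof.
move=> Pv.
have L2K K : L2 Omega (fun x => \1_((simplex (T K))°) x * v K x).
  have [c [a vE]] := Pv K; have [M hM] := simplex_bounded (T K).
  apply: (L2_bounded (M := `|c| + \sum_b `|a b| * M) mO mesh_finite).
    apply: measurable_funM; first by apply: measurable_indic; exact: measurable_interior.
    by apply: continuous_measurable_row; exact: P1_continuous.
  move=> x _; rewrite indicE; case: (boolP (x \in _)) => [|_]; last first.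
    rewrite mul0r normr0 addr_ge0 // sumr_ge0 // => b _; apply: mulr_ge0 => //.
    by apply: le_trans (hM (T K ord0) _ ord0) => //; exact: vertex_face.
  rewrite inE => /interior_subset xK; rewrite mul1r vE.
  apply: le_trans (ler_normD _ _) _; rewrite lerD2l.
  apply: le_trans (ler_norm_sum _ _ _) _; apply: ler_sum => b _.
  by rewrite normrM ler_wpM2l // hM.
have [|+ _] := linear_sum (W := L2 Omega) (l := fun=> 0) (L2_cst 0 mO mesh_finite) _ (fun=> 1) L2K.
  by move=> c u w Wu Ww; split; [exact: L2_lin|rewrite mulr0 addr0].
by under eq_fun do under eq_bigr do rewrite mul1r.
Qed.

Lemma load_lin c (u v : broken R n m) : (forall K, P1 (u K)) -> (forall K, P1 (v K)) ->
  load Omega T f (fun K x => c * u K x + v K x) = c * load Omega T f u + load Omega T f v.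
Proof.
move=> Pu Pv.
have gE : (fun x => f x * Defs.glue T (fun K x => c * u K x + v K x) x) =
    (fun x => c * (f x * Defs.glue T u x) + f x * Defs.glue T v x).
  apply/funext => x; rewrite mulrCA -mulrDr; congr (_ * _); rewrite /Defs.glue.
  by rewrite mulr_sumr -big_split /=; apply: eq_bigr => K _; rewrite mulrDr mulrCA.
have iu := L2_mul_integrable mO fL2 (glue_L2 Pu).
have iv := L2_mul_integrable mO fL2 (glue_L2 Pv).
rewrite /load gE -RintegralZl // RintegralD //.
exact: (integrableZl mO c iu).
Qed.

End load.

(** * The Galerkin and Petrov-Galerkin systems *)

Section forms.
Context {R : realType} {n m : nat}.
Variables (V : 'I_m -> set ('rV[R]_n.+1 -> R))
  (a : 'I_m -> ('rV[R]_n.+1 -> R) -> ('rV[R]_n.+1 -> R) -> R).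
Hypotheses (V0 : forall K, V K (fun=> 0))
  (Vlin : forall K c u v, V K u -> V K v -> V K (fun x => c * u x + v x))
  (bila : forall K, bilinear_on (V K) (a K)).

Let W : set (broken R n m) := [set u | forall K, V K (u K)].

Let Wlin c u v : W u -> W v -> W (fun K x => c * u K x + v K x).
Proof. by move=> Wu Wv K; exact: Vlin. Qed.

Lemma total_form_lincombl N (c : 'I_N -> R) (b : 'I_N -> broken R n m) v :
  (forall j K, V K (b j K)) -> (forall K, V K (v K)) ->
  (forall K, V K (lincomb c b K)) /\
  total_form a (lincomb c b) v = \sum_j c j * total_form a (b j) v.
Proof.
move=> Wb Wv; apply: (@linear_lincomb R n m W (total_form a ^~ v)) => // d u w Wu Ww.
split; first exact: Wlin.
by rewrite /total_form mulr_sumr -big_split; apply: eq_bigr => K _; exact: (bila d (Wu K) (Ww K) (Wv K)).1.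
Qed.

Lemma total_form_lincombr N (c : 'I_N -> R) (b : 'I_N -> broken R n m) v :
  (forall j K, V K (b j K)) -> (forall K, V K (v K)) ->
  total_form a v (lincomb c b) = \sum_j c j * total_form a v (b j).
Proof.
move=> Wb Wv; apply: (@linear_lincomb R n m W (total_form a v) _ _ _ _ _ _).2 => // d u w Wu Ww.
split; first exact: Wlin.
by rewrite /total_form mulr_sumr -big_split; apply: eq_bigr => K _; exact: (bila d (Wu K) (Ww K) (Wv K)).2.
Qed.

End forms.

Section msfem_theory.
Context {R : realType} {n m : nat}.
Variables (k : msfem) (Omega : set 'rV[R]_n.+1)
  (T : 'I_m -> 'I_n.+2 -> 'rV[R]_n.+1)
  (a : 'I_m -> ('rV[R]_n.+1 -> R) -> ('rV[R]_n.+1 -> R) -> R)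
  (f : 'rV[R]_n.+1 -> R) (N0 N : nat)
  (D : 'I_N -> set 'rV[R]_n.+1) (phi : 'I_N -> broken R n m)
  (phi0 : 'I_N0 -> broken R n m)
  (V : 'I_m -> set ('rV[R]_n.+1 -> R))
  (chi : 'I_m -> 'I_n.+2 -> 'rV[R]_n.+1 -> R).
Hypotheses (oO : open Omega) (meshT : conformal_mesh Omega T)
  (bila : forall K, bilinear_on (V K) (a K))
  (coera : forall K, exists2 al, 0 < al &
    forall u g, H1 (simplex (T K))° u -> weak_grad (simplex (T K))° u g ->
      al * \sum_b L2norm (simplex (T K))° (g b) ^+ 2 <= a K u u)
  (fL2 : L2 Omega f) (enumD : dof_enumeration k T D)
  (phiP1 : forall j K, P1 (phi j K)) (dualphi : dual_to k T D phi)
  (basis0 : is_basis (VH0 k Omega T) phi0)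
  (spaceV : forall K, sampling_space k (T K) (V K))
  (corr : forall K, correctors k (T K) (V K) (a K) (chi K)).

Let phie := fun j => multiscale T chi (phi0 j).

Let V0 K : V K (fun=> 0).
Proof. by have [_ _ _ h _] := spaceV K; apply: h; exact: P1_0. Qed.

Let Vlin K c u v : V K u -> V K v -> V K (fun x => c * u x + v x).
Proof. by have [_ + _ _ _] := spaceV K; exact. Qed.

Let phi0P1 j K : P1 (phi0 j K).
Proof. exact: VH0_P1 (basis0.1 j). Qed.

Let phi0V j K : V K (phi0 j K).
Proof. by have [_ _ _ h _] := spaceV K; exact: h. Qed.

Let phieV j K : V K (phie j K).
Proof. by rewrite /phie multiscaleE; apply: add_correctors_V. Qed.

Lemma galerkin_matrix i j :
  total_form a (phie i) (phie j) = total_form a (phie i) (phi0 j).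
Proof.
apply: eq_bigr => K _; rewrite /phie !multiscaleE.
exact: (add_correctors_formr (spaceV K) (@bila K) (corr K)).
Qed.

Let tfl v (e : 'I_N0 -> R) : (forall K, V K (v K)) ->
  (forall K, V K (lincomb e phie K)) /\
  total_form a (lincomb e phie) v = \sum_i e i * total_form a (phie i) v.
Proof. by move=> Vv; exact: (total_form_lincombl V0 Vlin bila). Qed.

Let spanV e K : V K (lincomb e phie K).
Proof. by have [] := tfl (v := fun _ _ => 0) e V0. Qed.

(** Bilinearity extends the equality of the matrices to the span of the phi_i^eps. *)
Lemma galerkin_row e j :
  total_form a (lincomb e phie) (phie j) = total_form a (lincomb e phie) (phi0 j).
Proof.
rewrite (tfl e (phieV j)).2 (tfl e (phi0V j)).2.
by apply: eq_bigr => i _; rewrite galerkin_matrix.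
Qed.

Let VH0_lincomb e : VH0 k Omega T (lincomb e phi0).
Proof.
have [|] // := linear_lincomb (l := fun=> 0) (VH0_0 k Omega T) _ e basis0.1.
by move=> c u v Vu Vv; split; [exact: VH0_lin|rewrite mulr0 addr0].
Qed.

Lemma petrov_galerkinP e :
  petrov_galerkin k Omega T a f phie (lincomb e phie) <->
  forall j, total_form a (lincomb e phie) (phi0 j) = load Omega T f (phi0 j).
Proof.
split=> [[_ h] j|h]; first by apply: h; exact: basis0.1.
split=> [|v /basis0.2[d [-> _]]]; first by exists e.
rewrite (total_form_lincombr V0 Vlin bila) //.
have [||_ ->] := linear_lincomb (W := [set u | forall K, P1 (u K)]) (l := load Omega T f) _ _ d phi0P1.
- by move=> K; exact: P1_0.
- move=> c u w Pu Pw; split; first by move=> K; exact: P1_lin.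
  exact: load_lin.
- by apply: eq_bigr => j _; rewrite h.
Qed.

(** The residual of u vanishes on the phi_j, hence on the phi_j^eps, so that a(u, u) = 0 and
the gradient of u is zero on each element. Its degrees of freedom on an element are
then equal, and they are those of the combination of the phi_j with the same
coefficients, which is piecewise constant and thus zero. *)
Lemma petrov_galerkin_inj e :
  (forall j, total_form a (lincomb e phie) (phi0 j) = 0) -> e = (fun=> 0).
Proof.
move=> e0; pose U := lincomb e phie.
have VU K : V K (U K) by exact: spanV.
have UU0 : total_form a U U = 0.
  rewrite [LHS](total_form_lincombr V0 Vlin bila) //.
  by rewrite big1 // => j _; rewrite galerkin_row e0 mulr0.
have H1U K : H1 (simplex (T K))° (U K) by have [h _ _ _ _] := spaceV K; exact: h.
have aU0 K : 0 <= a K (U K) (U K).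
  have [al al0 h] := coera K; have [_ [g gU]] := H1U K.
  apply: le_trans (h _ _ (H1U K) gU); rewrite mulr_ge0 ?(ltW al0) // sumr_ge0 // => b _.
  exact: sqr_ge0.
have aU K : a K (U K) (U K) = 0.
  apply/eqP; have /eqP := UU0; rewrite /total_form psumr_eq0 // => /allP; apply.
  by rewrite mem_index_enum.
have /choice[c cU] : forall K, exists c, forall i, dof k (T K) (U K) i = c.
  move=> K; apply: (dof_grad0 (spaceV K) (VU K)) => g gU b.
  have [al al0 h] := coera K; have := h _ _ (H1U K) gU.
  rewrite aU pmulr_rle0 // => s0; apply/eqP; rewrite -sqrf_eq0 eq_le sqr_ge0 andbT.
  by apply: le_trans s0; rewrite (bigD1 b) //= lerDl sumr_ge0 // => b' _; exact: sqr_ge0.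
have dofU K i : dof k (T K) (U K) i = dof_P1 k (T K) (lincomb e phi0 K) i.
  have [|_ ->] := linear_sum (W := V K) (l := fun u => dof k (T K) u i) (V0 K) _ e (fun j => phieV j K).
    by move=> d u v Vu Vv; split; [exact: Vlin|exact: (dof_lin (spaceV K))].
  have [|_ ->] := linear_sum (W := P1) (l := fun u => dof_P1 k (T K) u i) P1_0 _ e (fun j => phi0P1 j K).
    by move=> d u v Pu Pv; split; [exact: P1_lin|exact: dof_P1_lin].
  apply: eq_bigr => j _; rewrite /phie multiscaleE.
  by rewrite (dof_add_correctors (spaceV K) (corr K)).
have cst_phi0 K : lincomb e phi0 K = cst (c K).
  apply: (dof_P1_cst_inv (K := K) _ enumD dualphi) => //; first by case: meshT.
    exact: VH0_P1 (VH0_lincomb e).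
  by move=> i; rewrite -dofU.
have c0 := VH0_piecewise_constant oO meshT (VH0_lincomb e) cst_phi0.
have [d [_ du]] := basis0.2 _ (VH0_lincomb e).
rewrite -(du e erefl); apply: du.
apply/funext => K; rewrite cst_phi0 c0; apply/funext => x.
by rewrite /lincomb big1 // => j _; rewrite mul0r.
Qed.

(** The matrix of the system is square with a trivial kernel. *)
Lemma petrov_galerkin_exists_unique :
  exists! u, petrov_galerkin k Omega T a f phie u.
Proof.
pose A : 'M[R]_N0 := \matrix_(i, j) total_form a (phie i) (phi0 j).
have AE (e : 'rV[R]_N0) j :
    (e *m A) ord0 j = total_form a (lincomb (fun i => e ord0 i) phie) (phi0 j).
  by rewrite mxE (tfl _ (phi0V j)).2; apply: eq_bigr => i _; rewrite mxE.
have uA : A \in unitmx.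
  rewrite -row_free_unit -kermx_eq0; apply/rowV0P => e /sub_kermxP e0.
  have /petrov_galerkin_inj h j : total_form a (lincomb (fun i => e ord0 i) phie) (phi0 j) = 0.
    by rewrite -AE e0 mxE.
  by apply/rowP => i; rewrite mxE; exact: (congr1 (fun g => g i) h).
pose F : 'rV[R]_N0 := \row_j load Omega T f (phi0 j).
exists (lincomb (fun i => (F *m invmx A) ord0 i) phie); split.
  by apply/petrov_galerkinP => j; rewrite -AE mulmxKV // mxE.
move=> u pu; have [[e uE] _] := pu; move: pu; rewrite uE => /petrov_galerkinP he.
congr lincomb; apply/funext => i.
have -> : F = (\row_i e i) *m A.
  apply/rowP => j; rewrite mxE -he AE; congr (total_form _ (lincomb _ _) _).
  by apply/funext => i'; rewrite mxE.
by rewrite mulmxK // mxE.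
Qed.

End msfem_theory.

Theorem mainTheorem3 (R : realType) (n m : nat) (k : msfem)
  (Omega : set 'rV[R]_n.+1) (T : 'I_m -> 'I_n.+2 -> 'rV[R]_n.+1)
  (a : 'I_m -> ('rV[R]_n.+1 -> R) -> ('rV[R]_n.+1 -> R) -> R)
  (f : 'rV[R]_n.+1 -> R)
  (N0 N : nat) (leN : (N0 <= N)%N)
  (D : 'I_N -> set 'rV[R]_n.+1) (phi : 'I_N -> broken R n m)
  (V : 'I_m -> set ('rV[R]_n.+1 -> R))
  (s : 'I_m -> ('rV[R]_n.+1 -> R) -> ('rV[R]_n.+1 -> R) -> R)
  (chi : 'I_m -> 'I_n.+2 -> 'rV[R]_n.+1 -> R)
  (phi0 := fun j : 'I_N0 => phi (widen_ord leN j))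
  (phie := fun j : 'I_N0 => multiscale T chi (phi0 j)) :
  polytope Omega -> conformal_mesh Omega T ->
  (forall K, bilinear_on (H1 (simplex (T K))°) (a K) /\
    continuous_form (simplex (T K))° (a K)) ->
  coercive_form Omega a ->
  (forall K, exists2 al, 0 < al &
    forall u g, H1 (simplex (T K))° u -> weak_grad (simplex (T K))° u g ->
      al * \sum_b L2norm (simplex (T K))° (g b) ^+ 2 <= a K u u) ->
  L2 Omega f ->
  dof_enumeration k T D ->
  is_basis (VH k Omega T) phi -> dual_to k T D phi ->
  is_basis (VH0 k Omega T) phi0 ->
  (forall K, sampling_space k (T K) (V K)) ->
  (forall K, sampling_form k (T K) (V K) (s K)) ->
  (forall K, correctors k (T K) (V K) (s K) (chi K)) ->
  (forall K u v, V K u -> V K v -> s K u v = a K u v) ->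
  [/\ forall i j : 'I_N0,
        total_form a (phie i) (phie j) = total_form a (phie i) (phi0 j),
      forall u, nonintrusive_galerkin Omega T a f phi0 phie u <->
        petrov_galerkin k Omega T a f phie u
    & exists! u, petrov_galerkin k Omega T a f phie u].
Proof.
move=> [OE _] meshT contA _ coera fL2 enumD [VHphi _] dualphi basis0 spaceV _ corrs sa.
have oO : open Omega by rewrite OE; exact: open_interior.
have VH1 K : V K `<=` H1 (simplex (T K))° by case: (spaceV K).
have P1V K : P1 `<=` V K by case: (spaceV K).
have bila K : bilinear_on (V K) (a K).
  move=> c u v w /VH1 Hu /VH1 Hv /VH1 Hw; exact: (contA K).1.
have corr K : correctors k (T K) (V K) (a K) (chi K).
  move=> al; have [kchi eqchi] := corrs K al; split=> // w kw.
  have Vw := kw.1; have Vd : V K (corrector_data (T K) al) by apply: P1V; exact: corrector_data_P1.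
  by rewrite -!sa ?eqchi //; case: kchi.
have phiP1 j K : P1 (phi j K) by have [] := VHphi j.
split; last exact: (petrov_galerkin_exists_unique oO meshT bila coera fL2 enumD phiP1 dualphi basis0 spaceV corr).
  exact: (galerkin_matrix bila basis0 spaceV corr).
move=> u; split=> -[[e ->] h].
  apply/(petrov_galerkinP oO meshT bila fL2 basis0 spaceV corr) => j.
  by rewrite -(galerkin_row bila basis0 spaceV corr) h.
split=> [|j]; first by exists e.
rewrite (galerkin_row bila basis0 spaceV corr).
exact: h _ (basis0.1 j).
Qed.
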